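(* Let $p\in\mathbb N_+$ and let $(X^{(n)}_i)_{i\in T_n}$ be a sequence of mean-zero random fields as in the context, with $\alpha$-mixing coefficients $(\alpha_{\ell,n})_{\ell\ge1}$ (of order $p+1$). Suppose that there exists $r\in(p+2,\infty]$ such that $$\liminf_{n\to\infty}\frac{\sigma_n^2}{|T_n|}>0,\qquad \sup_{n,\,i\in T_n}\|X_i^{(n)}\|_r<\infty.$$ Then $$|\kappa_{p+2}(W_n)|\lesssim|T_n|^{-p/2}\Bigl(1+\sum_{\ell=1}^{\lfloor|T_n|^{1/d}\rfloor}\ell^{d(p+1)-1}\alpha_{\ell,n}^{(r-p-2)/r}\Bigr),$$ with an implicit constant independent of $n$. In particular, if, uniformly in $n$ and $1\le\ell\le\lfloor|T_n|^{1/d}\rfloor$, $\alpha_{\ell,n}^{(r-p-2)/r}\lesssim\ell^{-q}$ for some $q>0$, then $$|\kappa_{p+2}(W_n)|=\begin{cases}\mathcal O(|T_n|^{-p/2}),&q>d(p+1),\\ \mathcal O(|T_n|^{-p/2}\log|T_n|),&q=d(p+1),\\ \mathcal O(|T_n|^{p/2+1-q/d}),&q<d(p+1).\end{cases}$$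
   Context: Setting. Fix $d\in\mathbb N_+$. $T_1\subseteq T_2\subseteq\cdots$ are finite nonempty subsets of $\mathbb Z^d$ with $|T_n|\to\infty$. For each $n$, $(X^{(n)}_i)_{i\in T_n}$ is a family of real random variables with mean zero and finite second moments (no stationarity is assumed). Put $\sigma_n^2:=\operatorname{Var}(\sum_{i\in T_n}X^{(n)}_i)$ and $W_n:=\sigma_n^{-1}\sum_{i\in T_n}X^{(n)}_i$; statements about $W_n$ concern those $n$ with $\sigma_n>0$. $\|X\|_r:=(\mathbb E|X|^r)^{1/r}$ for $r<\infty$, and $\|X\|_\infty$ is the essential supremum norm. When $r=\infty$, ratios $(r-a)/r$ with finite $a$ are read as $1$. $\kappa_j(W_n)$ is the $j$-th cumulant of $W_n$. Mixing coefficients. For sub-$\sigma$-algebras $\mathcal A,\mathcal B$, $\alpha(\mathcal A,\mathcal B):=\sup_{A\in\mathcal A,B\in\mathcal B}|\mathbb P(A\cap B)-\mathbb P(A)\mathbb P(B)|$. For positive integers $\ell,q$, $\alpha^{[q]}_{\ell,n}:=0\vee\sup\{\alpha(\sigma(X^{(n)}_i:i\in U_1),\sigma(X^{(n)}_i:i\in U_2)):U_1,U_2\subseteq T_n,\ |U_1|\le q,\ d(U_1,U_2)\ge\ell\}$, where $d(U_1,U_2)=\min\{\|i_1-i_2\|:i_1\in U_1,i_2\in U_2\}$ and $\|\cdot\|$ is the maximum norm. Throughout, $\alpha_{\ell,n}:=\alpha_{\ell,n}^{[p+1]}$. $x\lesssim y$ means $x\le Cy$ for a constant $C$ not depending on $n$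 (or $\ell$). $\mathcal O$-notation is as $n\to\infty$. *)

(* Defs.v *)
From HB Require Import structures.
From mathcomp Require Import all_boot all_order all_algebra finmap.
From mathcomp Require Import all_classical all_reals all_analysis.
Export numFieldNormedType.Exports.

Set Implicit Arguments.
Unset Strict Implicit.
Unset Printing Implicit Defensive.

Import Order.TTheory GRing.Theory Num.Theory.

Local Open Scope classical_set_scope.
Local Open Scope ring_scope.

Section cumulant.
Context {disp : measure_display} {Omega : measurableType disp} {R : realType}.
Variables (P : probability Omega R) (X : Omega -> R).

(* The moment generating series E[exp (z X)] = \sum_k E[X^k] z^k / k! , cut
   after degree j. *)
Definition mgf_poly (j : nat) : {poly R} :=
  \poly_(k < j.+1) (fine 'E_P[fun w => X w ^+ k] / k`!%:R).

(* log E[exp (z X)] = \sum_j kappa_j z^j / j! as formal power series, with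
   log M = \sum_(k >= 1) (-1)^(k+1) (M - 1)^k / k. As M has constant
   coefficient 1, the terms k > j and the moments of order > j do not
   contribute to degree j; so only E|X|^j < oo is needed. *)
Definition cumulant (j : nat) : R :=
  j`!%:R * (\sum_(1 <= k < j.+1)
              ((-1) ^+ k.+1 / k%:R) *: (mgf_poly j - 1) ^+ k)`_j.

End cumulant.

Section mixing.
Context {disp : measure_display} {Omega : measurableType disp} {R : realType}.
Variable P : probability Omega R.

Definition alpha_mixing (A B : set (set Omega)) : R :=
  sup [set x | exists E F : set Omega, [/\ A E, B F &
         x = `|fine (P (E `&` F)) - fine (P E) * fine (P F)|]].

Variables (d : nat) (X : 'rV[int]_d -> {RV P >-> R}).

Definition sigma_field (U : {fset 'rV[int]_d}) : set (set Omega) :=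
  <<s \bigcup_(i in [set` U]) preimage_set_system setT (X i) measurable >>.

(* mx_norm is the maximum norm. When U1 or U2 is empty the condition
   d(U1, U2) >= l holds vacuously (min over the empty set is +oo). *)
Definition set_dist_ge (l : nat) (U1 U2 : {fset 'rV[int]_d}) : Prop :=
  forall i1 i2, i1 \in U1 -> i2 \in U2 -> l%:Z <= mx_norm (i1 - i2).

Definition alpha_coef (T : {fset 'rV[int]_d}) (q l : nat) : R :=
  Num.max 0 (sup [set x | exists U1 U2 : {fset 'rV[int]_d},
    [/\ (U1 `<=` T)%fset, (U2 `<=` T)%fset, (#|` U1| <= q)%N,
        set_dist_ge l U1 U2 &
        x = alpha_mixing (sigma_field U1) (sigma_field U2)]]).

Definition field_sum (T : {fset 'rV[int]_d}) (w : Omega) : R :=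
  \sum_(i <- T) X i w.

Definition field_var (T : {fset 'rV[int]_d}) : R := fine 'V_P[field_sum T].

Definition field_sd (T : {fset 'rV[int]_d}) : R := Num.sqrt (field_var T).

Definition normalized_sum (T : {fset 'rV[int]_d}) (w : Omega) : R :=
  (field_sd T)^-1 * field_sum T w.

End mixing.

(* (r - a) / r, read as 1 when r = +oo. *)
Definition ratio_exp {R : realType} (r : \bar R) (a : R) : R :=
  if r is r0%:E then (r0 - a) / r0 else 1.

Definition box_radius (R : realType) (d N : nat) : nat :=
  Num.truncn ((N%:R : R) `^ (d%:R)^-1).

(* Main.v *)
(** Write [kappa_{p+2}(W_n)] as [sigma_n^-(p+2)] times the sum of the joint
    cumulants of all [(p+2)]-tuples of sites. If the sites of a tuple fall into
    two groups at distance greater than [l], replacing each joint moment by the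
    product of the moments over the two groups makes the joint cumulant vanish;
    hence the cumulant is controlled by the error of this factorization. That
    error is a covariance: truncating the variables at level
    [H = alpha^(-1/r)] bounds it by a multiple of
    [alpha H^(p+2) + H^(p+2-r)], i.e. of [alpha_{l+1}^((r-p-2)/r)]. A tuple
    without such a gap lies within distance [(p+1) l] of its first site, so
    there are at most a multiple of [|T_n| l^(d(p+1))] of them, and summation by
    parts over [l] gives the bound. *)
Require Import Defs.
From HB Require Import structures.
From mathcomp Require Import all_boot all_order all_algebra finmap.
From mathcomp Require Import all_classical all_reals all_analysis.
From mathcomp Require Import measurable_realfun ess_sup_inf ring lra zify.

Set Implicit Arguments.
Unset Strict Implicit.
Unset Printing Implicit Defensive.

Import Order.TTheory GRing.Theory Num.Theory.

Local Open Scope classical_set_scope.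
Local Open Scope ring_scope.

(** * Sums over splittings and tuples *)

(** Two notions of cumulant have to meet: [cumulant] is a coefficient of a truncated formal
    logarithm, whereas the factorization argument works on tuples of sites. Both obey one recursion,
    which writes a moment as a sum, over the blocks containing a distinguished entry, of the
    cumulant of the block times the moment of the rest. Joint cumulants are therefore defined by
    this recursion, without set partitions, and for an arbitrary function [m] on sequences instead
    of a random vector. This freedom in [m] replaces any construction of independent copies: the
    factorized moments are just another [m], whose cumulant vanishes by algebra, and a Lipschitz
    estimate in [m] turns moment errors into cumulant errors. All its constants depend only on the
    order and on a moment bound, which gives uniformity in [n]. Mixing of order [p + 1] suffices
    because both groups of a [(p+2)]-tuple are nonempty. The sum may stop at [|T_n|^(1/d)] because
    beyond this radius the trivial count of all tuples is no larger than the count of tuples in a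
    ball. *)

Section Splits.
Context {I : eqType} {R : realFieldType}.
Implicit Types (s t u : seq I) (F G : seq I -> seq I -> R) (a : pred I).

(* The sum of [F t u] over the [2 ^ size s] ways to distribute the positions of [s]
   between two subsequences [t] and [u]. *)
Fixpoint split_sum s F : R :=
  if s is y :: s' then
    split_sum s' (fun t u => F (y :: t) u) + split_sum s' (fun t u => F t (y :: u))
  else F [::] [::].

Lemma eq_split_sum s F G :
    (forall t u, subseq t s -> subseq u s -> (size t + size u)%N = size s ->
       F t u = G t u) ->
  split_sum s F = split_sum s G.
Proof.
elim: s F G => [|y s IHs] F G eqFG /=; first exact: eqFG.
congr (_ + _); apply: IHs => t u ts us tu; apply: eqFG => //=.
- by rewrite eqxx.
- exact: subseq_trans us (subseq_cons _ _).
- by rewrite addSn tu.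
- exact: subseq_trans ts (subseq_cons _ _).
- by rewrite eqxx.
- by rewrite addnS tu.
Qed.

Lemma split_sumZ s (c : R) F :
  split_sum s (fun t u => c * F t u) = c * split_sum s F.
Proof. by elim: s F => [|y s IHs] F //=; rewrite !IHs mulrDr. Qed.

Lemma split_sum0 s : split_sum s (fun=> fun=> 0) = 0 :> R.
Proof. by elim: s => [//|y s /= ->]; rewrite addr0. Qed.

Lemma split_sumD s F G :
  split_sum s (fun t u => F t u + G t u) = split_sum s F + split_sum s G.
Proof. by elim: s F G => [|y s IHs] F G //=; rewrite !IHs addrACA. Qed.

Lemma split_sumB s F G :
  split_sum s (fun t u => F t u - G t u) = split_sum s F - split_sum s G.
Proof.
rewrite (eq_split_sum (G := fun t u => F t u + (-1) * G t u)).
  by rewrite split_sumD split_sumZ mulN1r.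
by move=> t u _ _ _; rewrite mulN1r.
Qed.

Lemma le_norm_split_sum s F (c : R) :
    (forall t u, subseq t s -> subseq u s -> (size t + size u)%N = size s ->
       `|F t u| <= c) ->
  `|split_sum s F| <= 2 ^+ size s * c.
Proof.
elim: s F => [|y s IHs] F leF /=; first by rewrite expr0 mul1r leF.
rewrite exprS -mulrA mulr2n mulrDl mul1r.
apply: (le_trans (ler_normD _ _)); apply: lerD; apply: IHs => t u ts us tu;
  apply: leF => //=; rewrite ?eqxx ?addnS ?addSn ?tu //.
- exact: subseq_trans us (subseq_cons _ _).
- exact: subseq_trans ts (subseq_cons _ _).
Qed.

(** Only the splitting that sends every position to [t] leaves [u] empty. The recursion for joint
    cumulants solves for exactly this term. *)
Lemma split_sum_nil s F :
  split_sum s F =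
  split_sum s (fun t u => if u is [::] then 0 else F t u) + F s [::].
Proof.
elim: s F => [|y s IHs] F /=; first by rewrite add0r.
by rewrite (IHs (fun t u => F (y :: t) u)) addrAC.
Qed.

(** The condition [all a t] forces every position outside [a] into [u], so only the positions inside
    [a] remain free. *)
Lemma split_sum_filter a s (g : seq I -> seq I -> seq I -> R) :
  split_sum s (fun t u =>
    if all a t then g t (seq.filter a u) (seq.filter (predC a) u) else 0) =
  split_sum (seq.filter a s) (fun t u => g t u (seq.filter (predC a) s)).
Proof.
elim: s g => [|y s IHs] g //=; case: (boolP (a y)) => ay /=.
  congr (_ + _); first exact: (IHs (fun t u v => g (y :: t) u v)).
  exact: (IHs (fun t u v => g t (y :: u) v)).
rewrite split_sum0 add0r.
exact: (IHs (fun t u v => g t u (y :: v))).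
Qed.

(** Repetitions are kept, as in the expansion of a power of [\sum_(i <- T) x i] (see
    [sum_exprE]). *)
Fixpoint tuple_sum (T : seq I) n (F : seq I -> R) : R :=
  if n is n'.+1 then \sum_(i <- T) tuple_sum T n' (fun s => F (i :: s))
  else F [::].

Lemma eq_tuple_sum T n (F G : seq I -> R) :
  (forall s, size s = n -> all (mem T) s -> F s = G s) ->
  tuple_sum T n F = tuple_sum T n G.
Proof.
elim: n F G => [|n IHn] F G eqFG /=; first exact: eqFG.
rewrite big_seq [RHS]big_seq; apply: eq_bigr => i iT; apply: IHn => s sn sT.
by apply: eqFG => /=; rewrite ?sn // iT.
Qed.

Lemma tuple_sumD T n (F G : seq I -> R) :
  tuple_sum T n (fun s => F s + G s) = tuple_sum T n F + tuple_sum T n G.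
Proof.
elim: n F G => [//|n IHn] F G /=.
by rewrite -big_split; apply: eq_bigr => i _; exact: IHn.
Qed.

Lemma tuple_sumZ T n (c : R) (F : seq I -> R) :
  tuple_sum T n (fun s => c * F s) = c * tuple_sum T n F.
Proof.
elim: n F => [//|n IHn] F /=.
by rewrite mulr_sumr; apply: eq_bigr => i _; exact: IHn.
Qed.

Lemma tuple_sum_sum T n (J : Type) (r : seq J) (F : J -> seq I -> R) :
  tuple_sum T n (fun s => \sum_(j <- r) F j s) =
  \sum_(j <- r) tuple_sum T n (F j).
Proof.
elim: n F => [//|n IHn] F /=.
under eq_bigr do rewrite IHn.
exact: exchange_big.
Qed.

Lemma le_tuple_sum T n (F G : seq I -> R) :
  (forall s, size s = n -> all (mem T) s -> F s <= G s) ->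
  tuple_sum T n F <= tuple_sum T n G.
Proof.
elim: n F G => [|n IHn] F G leFG /=; first exact: leFG.
rewrite big_seq [leRHS]big_seq; apply: ler_sum => i iT; apply: IHn => s sn sT.
by apply: leFG => /=; rewrite ?sn // iT.
Qed.

Lemma le_norm_tuple_sum T n (F : seq I -> R) :
  `|tuple_sum T n F| <= tuple_sum T n (fun s => `|F s|).
Proof.
elim: n F => [//|n IHn] F /=.
by apply: le_trans (ler_norm_sum _ _ _) _; apply: ler_sum => i _; exact: IHn.
Qed.

Lemma tuple_sum_cst T n (c : R) :
  tuple_sum T n (fun=> c) = (size T)%:R ^+ n * c.
Proof.
elim: n => [|n IHn] /=; first by rewrite mul1r.
rewrite IHn.
by rewrite big_const_seq count_predT iter_addr_0 exprS -mulrA [RHS]mulr_natl.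
Qed.

Lemma tuple_sum_all T n a :
  tuple_sum T n (fun s => (all a s)%:R) = (count a T)%:R ^+ n.
Proof.
elim: n => [//|n IHn] /=.
rewrite exprS -{}IHn.
have -> : (count a T)%:R = \sum_(i <- T) (a i)%:R :> R.
  by elim: (T) => [|i T' IH]; rewrite ?big_nil //= big_cons natrD IH.
rewrite mulr_suml; apply: eq_bigr => i _.
rewrite -tuple_sumZ; apply: eq_tuple_sum => s _ _.
by rewrite -natrM mulnb.
Qed.

(** After summation over all tuples a splitting matters only through the number [k] of positions
    sent to [t], and ['C(n, k)] splittings share it. The induction removes the first position;
    Pascal's rule joins its two destinations. *)
Lemma tuple_sum_split T n (f g : seq I -> R) :
  tuple_sum T n (fun s => split_sum s (fun t u => f t * g u)) =
  \sum_(k < n.+1) 'C(n, k)%:R * (tuple_sum T k f * tuple_sum T (n - k) g).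
Proof.
elim: n f g => [|n IHn] f g /=; first by rewrite big_ord1 mul1r.
under eq_bigr do rewrite tuple_sumD.
rewrite big_split /=.
rewrite (eq_bigr (fun i => \sum_(k < n.+1) 'C(n, k)%:R *
  (tuple_sum T k (fun t => f (i :: t)) * tuple_sum T (n - k) g))); last first.
  by move=> i _; exact: IHn.
rewrite [X in _ + X](eq_bigr (fun i => \sum_(k < n.+1) 'C(n, k)%:R *
  (tuple_sum T k f * tuple_sum T (n - k) (fun t => g (i :: t))))); last first.
  by move=> i _; exact: IHn.
rewrite exchange_big /= [X in _ + X]exchange_big /=.
have -> : \sum_(k < n.+1) \sum_(i <- T) 'C(n, k)%:R *
    (tuple_sum T k (fun t => f (i :: t)) * tuple_sum T (n - k) g) =
    \sum_(k < n.+1) 'C(n, k)%:R * (tuple_sum T k.+1 f * tuple_sum T (n - k) g).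
  by apply: eq_bigr => k _; rewrite -mulr_sumr -mulr_suml.
have -> : \sum_(k < n.+1) \sum_(i <- T) 'C(n, k)%:R *
    (tuple_sum T k f * tuple_sum T (n - k) (fun t => g (i :: t))) =
    \sum_(k < n.+1) 'C(n, k)%:R * (tuple_sum T k f * tuple_sum T (n.+1 - k) g).
  apply: eq_bigr => k _; rewrite -mulr_sumr -mulr_sumr.
  by rewrite subSn // -ltnS.
rewrite [RHS]big_ord_recl bin0 subn0 mul1r.
under [X in _ = _ + X]eq_bigr => k _ do
  rewrite lift0 binS natrD mulrDl subSS.
rewrite big_split /= addrCA [RHS]addrA [RHS]addrC; congr (_ + _).
rewrite big_ord_recl bin0 subn0 mul1r [LHS]addrC; congr (_ + _).
rewrite [RHS]big_ord_recr /= bin_small // mul0r addr0.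
by apply: eq_bigr => k _; rewrite /= ?lift0 ?subSS.
Qed.

End Splits.

(** * Joint cumulants of a function on tuples *)

Section JointCumulant.
Context {I : eqType} {R : realFieldType}.
Implicit Types (s t u : seq I) (m : seq I -> R) (a : pred I).

(** [t] is no syntactic subterm of [s], hence the fuel [n]; any fuel above [size s] gives the same
    value. The case [u = [::]] is set to 0 because it is the circular term [t = s]. *)
Fixpoint joint_cumulant_rec n m x s : R :=
  if n is n'.+1 then
    m (x :: s) - split_sum s (fun t u =>
      if u is [::] then 0 else joint_cumulant_rec n' m x t * m u)
  else 0.

(* The joint cumulant of the tuple [x :: s], computed from the joint moments [m]
   by splitting off the block that contains [x]. *)
Definition joint_cumulant m x s : R := joint_cumulant_rec (size s).+1 m x s.

Lemma joint_cumulant_rec_size n m x s : (size s < n)%N ->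
  joint_cumulant_rec n m x s = joint_cumulant m x s.
Proof.
rewrite /joint_cumulant.
have [k] := ubnP (size s); elim: k => // k IHk in n s *.
rewrite ltnS => sk; case: n => // n; rewrite ltnS => sn /=.
congr (_ - _); apply: eq_split_sum => t [|y u] //= _ _ tu.
have ts : (size t < size s)%N by rewrite -tu addnS ltnS leq_addr.
congr (_ * _); rewrite (IHk n) ?(leq_trans ts) //.
by rewrite -(IHk (size s)) // (leq_trans ts).
Qed.

Lemma joint_cumulantE m x s :
  joint_cumulant m x s = m (x :: s) - split_sum s (fun t u =>
    if u is [::] then 0 else joint_cumulant m x t * m u).
Proof.
rewrite {1}/joint_cumulant /=; congr (_ - _).
apply: eq_split_sum => t [|y u] //= _ _ tu.
by rewrite joint_cumulant_rec_size // -tu addnS ltnS leq_addr.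
Qed.

(** Since [m [::] = 1], the omitted term [u = [::]] is the cumulant of the whole tuple. Putting it
    back gives a convolution, the form that is matched with power series below. *)
Lemma split_sum_joint_cumulant m x s : m [::] = 1 ->
  split_sum s (fun t u => joint_cumulant m x t * m u) = m (x :: s).
Proof.
by move=> m1; rewrite split_sum_nil m1 mulr1 [X in _ + X]joint_cumulantE addrC subrK.
Qed.

Lemma joint_cumulant_homog m (c : R) x s :
  joint_cumulant (fun u => c ^+ size u * m u) x s =
  c ^+ (size s).+1 * joint_cumulant m x s.
Proof.
have [k] := ubnP (size s); elim: k => // k IHk in s *; rewrite ltnS => sk.
rewrite !joint_cumulantE mulrBr; congr (_ - _).
rewrite -split_sumZ; apply: eq_split_sum => t [|y u] _ _ tu; first by rewrite mulr0.
have ts : (size t < size s)%N by rewrite -tu addnS ltnS leq_addr.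
rewrite IHk ?(leq_trans ts) // mulrACA -exprD mulrA.
by rewrite addSn tu -mulrA.
Qed.

(* The moments on the left are those of a family whose groups [a] and [~ a] are
   independent. *)
Lemma joint_cumulant_split m a x s : m [::] = 1 -> a x ->
  joint_cumulant (fun u => m (seq.filter a u) * m (seq.filter (predC a) u)) x s =
  if all a s then joint_cumulant m x s else 0.
Proof.
move=> m1 ax; set m' := fun u => _.
have [k] := ubnP (size s); elim: k => // k IHk in s *; rewrite ltnS => sk.
rewrite joint_cumulantE.
case: ifPn => [|nas].
  rewrite (joint_cumulantE m) => sa; congr (_ - _).
    have /all_filterP : all a (x :: s) by rewrite /= ax.
    rewrite /m' => ->; rewrite (_ : seq.filter _ _ = [::]) ?m1 ?mulr1 //=.
    rewrite ax /=; apply/eqP; rewrite -(negbK (_ == _)) -has_filter has_predC.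
    by rewrite sa.
  apply: eq_split_sum => t [|y u] // ts us tu.
  have lt_ts : (size t < size s)%N by rewrite -tu addnS ltnS leq_addr.
  have sub v : subseq v s -> all a v.
    by move=> vs; apply/allP => z /(mem_subseq vs); exact/allP.
  rewrite IHk ?(leq_trans lt_ts) // sub // /m'.
  have /all_filterP -> := sub _ us.
  rewrite (_ : seq.filter (predC a) _ = [::]) ?m1 ?mulr1 //.
  apply/eqP; rewrite -(negbK (_ == _)) -has_filter has_predC.
  by rewrite sub.
rewrite (eq_split_sum (G := fun t u => if all a t then
    joint_cumulant m x t * m (seq.filter a u) * m (seq.filter (predC a) u) else 0)).
  rewrite (split_sum_filter a s (fun t u v => joint_cumulant m x t * m u * m v)).
  rewrite (eq_split_sum (G := fun t u => m (seq.filter (predC a) s) *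
    (joint_cumulant m x t * m u))); last by move=> t u _ _ _; rewrite mulrC.
  by rewrite split_sumZ split_sum_joint_cumulant // /m' /= ax /= mulrC subrr.
move=> t [|y u] ts _ tu.
  rewrite addn0 in tu; have := size_subseq_leqif ts; case=> _; rewrite tu eqxx.
  by move=> /esym/eqP ->; rewrite (negPf nas).
have lt_ts : (size t < size s)%N by rewrite -tu addnS ltnS leq_addr.
by rewrite IHk ?(leq_trans lt_ts) //; case: ifP; rewrite ?mul0r // mulrA.
Qed.

(** The order of the quantifiers matters: [D] depends on [B] and [n] only, so one constant serves
    all fields and all tuples. *)
Lemma joint_cumulant_bound (B : R) n : 0 <= B -> exists2 D, 0 <= D &
  forall m x s, (size s <= n)%N ->
    (forall u, subseq u (x :: s) -> `|m u| <= B) -> `|joint_cumulant m x s| <= D.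
Proof.
move=> B0; elim: n => [|n [D D0 IHn]].
  exists B => // m x [|//] _ mB; rewrite joint_cumulantE /= subr0.
  by apply: mB; rewrite subseq_refl.
exists (B + 2 ^+ n.+1 * (D * B)); first by rewrite addr_ge0 ?mulr_ge0 ?exprn_ge0.
move=> m x s sn mB; rewrite joint_cumulantE.
apply: le_trans (ler_normB _ _) _; apply: lerD; first exact: mB.
have DB0 : 0 <= D * B by rewrite mulr_ge0.
apply: le_trans (_ : 2 ^+ size s * (D * B) <= _); last first.
  by rewrite ler_wpM2r // ler_eXn2l // ltr1n.
apply: le_norm_split_sum => t [|y u] ts us tu; first by rewrite normr0.
have lt_ts : (size t < size s)%N by rewrite -tu addnS ltnS leq_addr.
rewrite normrM ler_pM //; last first.
  by apply: mB; apply: subseq_trans us (subseq_cons _ _).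
apply: IHn => [|v vt]; first by rewrite -ltnS (leq_trans lt_ts).
by apply: mB; apply: subseq_trans vt _; rewrite /= eqxx.
Qed.

(** In the recursion each difference of products is telescoped,
    [k m - k' m' = (k - k') m + k' (m - m')], with [k'] controlled by [joint_cumulant_bound]. Again
    [D] is chosen before [m], [m'] and [e]. *)
Lemma joint_cumulant_lipschitz (B : R) n : 0 <= B -> exists2 D, 0 <= D &
  forall m m' x s (e : R), (size s <= n)%N ->
    (forall u, subseq u (x :: s) -> [/\ `|m u| <= B, `|m' u| <= B & `|m u - m' u| <= e]) ->
    `|joint_cumulant m x s - joint_cumulant m' x s| <= D * e.
Proof.
move=> B0; elim: n => [|n [D D0 IHn]].
  exists 1 => // m m' x [|//] e _ mB; rewrite !joint_cumulantE /= !subr0 mul1r.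
  by have [] := mB [:: x] (subseq_refl _).
have [D' D'0 bD'] := joint_cumulant_bound n B0.
exists (1 + 2 ^+ n.+1 * (D * B + D')).
  by rewrite !addr_ge0 ?mulr_ge0 ?addr_ge0 ?exprn_ge0 ?mulr_ge0.
move=> m m' x s e sn mB.
have e0 : 0 <= e by have [_ _] := mB _ (subseq_refl _); apply: le_trans.
rewrite !joint_cumulantE opprD addrACA -opprD -split_sumB mulrDl mul1r.
apply: le_trans (ler_normB _ _) _; apply: lerD; first by have [] := mB _ (subseq_refl _).
have DB0 : 0 <= (D * B + D') * e by rewrite mulr_ge0 ?addr_ge0 ?mulr_ge0.
rewrite -mulrA; apply: le_trans (_ : 2 ^+ size s * ((D * B + D') * e) <= _); last first.
  by rewrite ler_wpM2r // ler_eXn2l // ltr1n.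
apply: le_norm_split_sum => t [|y u] ts us tu; first by rewrite subr0 normr0.
have lt_ts : (size t < size s)%N by rewrite -tu addnS ltnS leq_addr.
have tn : (size t <= n)%N by rewrite -ltnS (leq_trans lt_ts).
have [mu mu' muu'] := mB _ (subseq_trans us (subseq_cons _ _)).
have sub v : subseq v (x :: t) -> subseq v (x :: s).
  by move=> vt; apply: subseq_trans vt _; rewrite /= eqxx.
have dk : `|joint_cumulant m x t - joint_cumulant m' x t| <= D * e.
  by apply: IHn => // v vt; exact: mB (sub _ vt).
have k' : `|joint_cumulant m' x t| <= D'.
  by apply: bD' => // v vt; have [] := mB _ (sub _ vt).
rewrite (_ : _ - _ = (joint_cumulant m x t - joint_cumulant m' x t) * m (y :: u) +
   joint_cumulant m' x t * (m (y :: u) - m' (y :: u))); last by ring.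
rewrite [leRHS]mulrDl (le_trans (ler_normD _ _)) // !normrM lerD //.
  by rewrite mulrAC ler_pM.
by rewrite ler_pM.
Qed.

End JointCumulant.

(** * The truncated logarithm of a moment series *)

Section LogSeries.
Context {R : realFieldType}.
Implicit Types M : {poly R}.

Definition log_poly j M : {poly R} :=
  \sum_(1 <= k < j.+1) ((-1) ^+ k.+1 / k%:R) *: (M - 1) ^+ k.

(* [(log M)' = M' / M], up to terms of degree at least [j] when [M] has constant
   coefficient 1. *)
Lemma deriv_log_poly j M :
  M * (log_poly j M)^`() = M^`() * (1 - (1 - M) ^+ j).
Proof.
rewrite /log_poly big_add1 /= big_mkord raddf_sum /=.
have -> : \sum_(i < j) (((-1) ^+ i.+2 / i.+1%:R) *: (M - 1) ^+ i.+1)^`() =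
    M^`() * (\sum_(i < j) (1 - M) ^+ i).
  rewrite mulr_sumr; apply: eq_bigr => i _.
  rewrite derivZ deriv_exp derivB derivC subr0 /= -[_ * _ *+ _]scaler_nat scalerA.
  rewrite divfK ?pnatr_eq0 // scalerAr -[1 - M]opprB [(- (M - 1)) ^+ _]exprNn; congr (_ * _).
  rewrite !exprS !mulN1r opprK -signr_odd -[in RHS]signr_odd.
  by case: odd; rewrite ?expr1 ?expr0 ?scaleN1r ?mulN1r ?scale1r ?mul1r.
rewrite mulrCA; congr (_ * _).
have := subrX1 (1 - M) j; rewrite [1 - M - 1]addrAC subrr add0r mulNr => e.
by rewrite -[RHS]opprB e opprK.
Qed.

(** Compare the coefficients of degree [n] in [deriv_log_poly] and multiply by [n!]. As [1 - M] is
    divisible by ['X], the correction [(1 - M) ^+ j] does not reach degree [n < j]. The derivatives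
    shift [k] to [k.+1]. *)
Lemma log_poly_moments j M n : M`_0 = 1 -> (n < j)%N ->
  \sum_(k < n.+1) 'C(n, k)%:R *
    ((k.+1`!%:R * (log_poly j M)`_k.+1) * ((n - k)`!%:R * M`_(n - k))) =
  n.+1`!%:R * M`_n.+1.
Proof.
move=> M0 nj.
have factn0 k : k`!%:R != 0 :> R by rewrite pnatr_eq0 -lt0n fact_gt0.
have := congr1 (fun p : {poly R} => p`_n) (deriv_log_poly j M).
rewrite mulrBr mulr1 coefB [X in _ - X](_ : _ = 0) ?subr0; last first.
  have /factor_theorem [q qE] : root (1 - M) 0.
    by rewrite rootE horner_coef0 coefB coefC M0 subrr.
  by rewrite qE subr0 exprMn mulrA coefMXn nj.
rewrite coefMr coef_deriv => e.
transitivity (n`!%:R * (M`_n.+1 *+ n.+1)); last first.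
  by rewrite factS natrM -(mulr_natr M`_n.+1) (mulrC M`_n.+1) mulrA (mulrC n`!%:R).
rewrite -e mulr_sumr; apply: eq_bigr => -[k ltkn] _.
have kn : (k <= n)%N by rewrite -ltnS.
rewrite [nat_of_ord _]/=.
rewrite coef_deriv -(bin_fact kn) factS !natrM -(mulr_natr (log_poly j M)`_k.+1); ring.
Qed.

(** Both sides solve the same recursion: the left by [log_poly_moments], the right by summing
    [split_sum_joint_cumulant] over all tuples [x :: s]. In it the term [k = n] has coefficient 1,
    so the terms [k < n] determine it and strong induction applies. *)
Lemma log_poly_tuple_sum (I : eqType) (T : seq I) (m : seq I -> R) j M :
    m [::] = 1 -> (forall k, (k <= j)%N -> k`!%:R * M`_k = tuple_sum T k m) ->
  forall n, (n < j)%N ->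
    n.+1`!%:R * (log_poly j M)`_n.+1 =
    \sum_(x <- T) tuple_sum T n (joint_cumulant m x).
Proof.
move=> m1 mM n; have [N] := ubnP n; elim: N => // N IHN in n *.
rewrite ltnS => nN nj.
have M0 : M`_0 = 1 by rewrite -[LHS]mul1r (mM 0%N) //= m1.
have := log_poly_moments M0 nj.
rewrite mM // => e.
have e2 : \sum_(k < n.+1) 'C(n, k)%:R *
    ((\sum_(x <- T) tuple_sum T k (joint_cumulant m x)) * tuple_sum T (n - k) m) =
    tuple_sum T n.+1 m.
  under eq_bigr => k _ do rewrite mulr_suml mulr_sumr.
  rewrite exchange_big /=; apply: eq_bigr => x _.
  rewrite -tuple_sum_split; apply: eq_tuple_sum => s _ _.
  exact: split_sum_joint_cumulant.
move: e; rewrite -e2 !big_ord_recr /= binn subnn !mul1r /= m1 M0 !mulr1.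
rewrite (eq_bigr (fun k : 'I_n => 'C(n, k)%:R *
    ((\sum_(x <- T) tuple_sum T k (joint_cumulant m x)) * tuple_sum T (n - k) m))).
  exact: addrI.
move=> k _; have kj : (k < j)%N := ltn_trans (ltn_ord k) nj.
rewrite (IHN k (leq_trans (ltn_ord k) nN) kj) mM //.
by rewrite (leq_trans (leq_subr _ _)) // ltnW.
Qed.

End LogSeries.

(** * Covariance of bounded random variables *)

Section RealIntegral.
Context {d : measure_display} {Omega : measurableType d} {R : realType}.
Variable P : probability Omega R.
Implicit Types f g : Omega -> R.

Local Notation intg f := (P.-integrable setT (EFin \o f)).

Lemma integrable_bounded f (c : R) :
  measurable_fun setT f -> (forall w, `|f w| <= c) -> intg f.
Proof.
move=> mf fc; apply: measurable_bounded_integrable => //.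
  by rewrite (le_lt_trans (probability_le1 _ _)) // ltry.
exists c; split; first exact: num_real.
by move=> x cx w _ /=; apply: le_trans (fc w) _; exact: ltW.
Qed.

Lemma integrable_dominated f g :
  measurable_fun setT f -> intg g -> (forall w, `|f w| <= g w) -> intg f.
Proof.
move=> mf ig fg; apply: (le_integrable _ _ _ ig) => //=.
  exact/measurable_EFinP.
by move=> w _ /=; rewrite lee_fin (le_trans (fg w)) // ler_norm.
Qed.

Lemma integrableD_EFin f g : intg f -> intg g -> intg (fun w => f w + g w).
Proof. by move=> intf intg; have := integrableD measurableT intf intg. Qed.

Lemma integrableB_EFin f g : intg f -> intg g -> intg (fun w => f w - g w).
Proof. by move=> intf intg; have := integrableB measurableT intf intg. Qed.

Lemma integrableZl_EFin f (c : R) : intg f -> intg (fun w => c * f w).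
Proof. by move=> intf; have := integrableZl measurableT c intf. Qed.

Lemma integrable_sum_EFin (J : Type) (r : seq J) (F : J -> Omega -> R) :
  (forall j, intg (F j)) -> intg (fun w => \sum_(j <- r) F j w).
Proof.
move=> iF; elim: r => [|j r IHr].
  apply: (@integrable_bounded _ 0) => [|w]; last by rewrite big_nil normr0.
  rewrite (_ : (fun _ => _) = cst 0); first exact: measurable_cst.
  by apply/funext => w; rewrite big_nil.
rewrite (_ : (fun _ => _) = fun w => F j w + \sum_(i <- r) F i w).
  exact: integrableD_EFin.
by apply/funext => w; rewrite big_cons.
Qed.

Lemma Rintegral_sum (J : Type) (r : seq J) (F : J -> Omega -> R) :
  (forall j, intg (F j)) ->
  \int[P]_w (\sum_(j <- r) F j w) = \sum_(j <- r) \int[P]_w F j w.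
Proof.
move=> iF; elim: r => [|j r IHr].
  under eq_Rintegral do rewrite big_nil.
  by rewrite big_nil Rintegral_cst // mul0r.
under eq_Rintegral do rewrite big_cons.
by rewrite big_cons RintegralD ?IHr //; exact: integrable_sum_EFin.
Qed.

Lemma Rintegral_prob_cst (c : R) : \int[P]_w c = c.
Proof.
rewrite Rintegral_cst // -[RHS]mulr1; congr (_ * _).
exact: (congr1 fine (probability_setT P)).
Qed.

Lemma Rintegral_indic (A : set Omega) : measurable A ->
  \int[P]_w (\1_A w) = fine (P A).
Proof. by move=> mA; rewrite /Rintegral integral_indic // setIT. Qed.

Lemma le_norm_Rintegral f (c : R) : intg f -> (forall w, `|f w| <= c) ->
  `|\int[P]_w f w| <= c.
Proof.
move=> intf fc; apply: le_trans (le_normr_Rintegral measurableT intf) _.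
rewrite -[leRHS]Rintegral_prob_cst; apply: le_Rintegral => //.
- exact: integrable_norm.
- by apply: (@integrable_bounded _ `|c|) => // w.
Qed.

Lemma le_norm_RintegralB f g h : intg f -> intg g -> intg h ->
  (forall w, `|f w - g w| <= h w) ->
  `|\int[P]_w f w - \int[P]_w g w| <= \int[P]_w h w.
Proof.
move=> intf intg inth fg; rewrite -RintegralB //.
apply: le_trans (le_normr_Rintegral measurableT (integrableB_EFin intf intg)) _.
apply: le_Rintegral => //.
exact: integrable_norm (integrableB_EFin intf intg).
Qed.

End RealIntegral.

Section BoundedCovariance.
Context {R : realType}.

(* [min K (floor x)] for [0 <= x], as a count of level sets. *)
Fixpoint step_count (K : nat) (x : R) : nat :=
  if K is K'.+1 then (step_count K' x + (K'.+1%:R <= x)%R)%N else 0%N.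

Lemma step_countP K (x : R) : 0 <= x ->
  [/\ (step_count K x <= K)%N, (step_count K x)%:R <= x &
      (x < (step_count K x).+1%:R) || (step_count K x == K)].
Proof.
move=> x0; elim: K => [|K [leK lex ltx]] /=; first by split => //; rewrite orbT.
have [Kx|xK] := leP K.+1%:R x; last first.
  rewrite addn0; split => //; first exact: leqW.
  by case/orP: ltx => [->//|/eqP e]; rewrite e xK.
have /eqP e : step_count K x == K.
  case/orP: ltx => // ltx; have := le_lt_trans Kx ltx.
  by rewrite ltr_nat ltnS ltnNge leK.
by rewrite e addn1; split => //; rewrite eqxx orbT.
Qed.

(** A discrete layer-cake formula: it turns integrals of step functions into sums of probabilities
    of level sets. *)
Lemma step_countE K (x : R) :
  (step_count K x)%:R = \sum_(k < K) (k.+1%:R <= x)%R%:R :> R.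
Proof. by elim: K => [|K IHK] /=; rewrite ?big_ord0 // big_ord_recr /= natrD IHK. Qed.

Lemma step_count_approx K (x : R) : (0 < K)%N -> 0 <= x <= 1 ->
  [/\ 0 <= (step_count K (K%:R * x))%:R / K%:R :> R,
      (step_count K (K%:R * x))%:R / K%:R <= 1 :> R &
      `|x - (step_count K (K%:R * x))%:R / K%:R| <= K%:R^-1].
Proof.
move=> K0 /andP[x0 x1]; have K0' : 0 < K%:R :> R by rewrite ltr0n.
have [leK lex ltx] := step_countP K (mulr_ge0 (ltW K0') x0).
split; first by rewrite divr_ge0.
  by rewrite ler_pdivrMr // mul1r ler_nat.
have xE : x = (K%:R * x) / K%:R by rewrite mulrAC divff ?gt_eqF // mul1r.
rewrite {1}xE -mulrBl normrM (gtr0_norm (_ : 0 < K%:R^-1)) ?invr_gt0 //.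
rewrite ler_piMl ?invr_ge0 ?(ltW K0') // ger0_norm ?subr_ge0 //.
case/orP: ltx => [/ltW|/eqP ->]; first by rewrite -natr1 => ?; lra.
by have : K%:R * x <= K%:R; [rewrite ler_piMr // ltW|move=> ?; lra].
Qed.

Context {d : measure_display} {Omega : measurableType d}.
Variable P : probability Omega R.
Implicit Types f g : Omega -> R.

Local Notation intg f := (P.-integrable setT (EFin \o f)).

(** A discrete form of Hoeffding's covariance identity: for step functions with [K] equally spaced
    levels, the covariance is the average of the [K ^ 2] dependences between level sets, each at
    most [delta]. The approximation error vanishes as [K] grows. *)
Lemma cov_le_unit f g (delta : R) :
    measurable_fun setT f -> measurable_fun setT g ->
    (forall w, 0 <= f w <= 1) -> (forall w, 0 <= g w <= 1) ->
    (forall a b : R, `|fine (P ([set w | a <= f w] `&` [set w | b <= g w])) -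
       fine (P [set w | a <= f w]) * fine (P [set w | b <= g w])| <= delta) ->
  `|\int[P]_w (f w * g w) - \int[P]_w f w * \int[P]_w g w| <= delta.
Proof.
move=> mf mg f01 g01 dP; apply/ler_addgt0Pr => e e0.
(* Passing to step functions costs [2 / K] in the integral of the product and again [2 / K] in the
   product of the integrals. *)
pose K := (Num.truncn (4 / e)).+1.
have K0 : 0 < K%:R :> R by rewrite ltr0n.
have eK : 4 / K%:R <= e.
  by rewrite ler_pdivrMr // mulrC -ler_pdivrMr // ltW // truncnS_gt.
pose A (h : Omega -> R) (k : 'I_K) := [set w : Omega | k.+1%:R / K%:R <= h w :> R].
pose st (h : Omega -> R) (w : Omega) : R := (step_count K (K%:R * h w))%:R / K%:R.
have mA h k : measurable_fun setT h -> measurable (A h k).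
  move=> mh; rewrite -[A h k]setTI.
  exact: (measurable_fun_le measurableT (measurable_cst _) mh).
have i1 B : measurable B -> intg (\1_B : Omega -> R).
  by move=> mB; exact: integrable_indic.
have stE h : st h = fun w => K%:R^-1 * \sum_(k < K) (\1_(A h k) w : R).
  apply/funext => w; rewrite /st step_countE mulrC; congr (_ * _).
  apply: eq_bigr => k _; rewrite indicE; congr (_%:R); congr nat_of_bool.
  apply/idP/idP => [le|]; first by apply/mem_set; rewrite /A /= ler_pdivrMr // mulrC.
  by move/set_mem; rewrite /A /= ler_pdivrMr // mulrC.
have ist h : measurable_fun setT h -> intg (st h).
  move=> mh; rewrite stE; apply: integrableZl_EFin.
  by apply: integrable_sum_EFin => k; exact/i1/mA.
have Est h : measurable_fun setT h ->
    \int[P]_w st h w = K%:R^-1 * \sum_(k < K) fine (P (A h k)).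
  move=> mh; rewrite stE RintegralZl //; last first.
    by apply: integrable_sum_EFin => k; exact/i1/mA.
  rewrite Rintegral_sum; last by move=> k; exact/i1/mA.
  by congr (_ * _); apply: eq_bigr => k _; rewrite Rintegral_indic //; exact: mA.
have stMw w : st f w * st g w = K%:R^-1 ^+ 2 *
    \sum_(k < K) \sum_(l < K) (\1_(A f k `&` A g l) w : R).
  rewrite !stE mulrACA -expr2 mulr_suml; congr (_ * _); apply: eq_bigr => k _.
  by rewrite mulr_sumr; apply: eq_bigr => l _; rewrite indicI.
have stM : (fun w => st f w * st g w) = fun w => K%:R^-1 ^+ 2 *
    \sum_(k < K) \sum_(l < K) (\1_(A f k `&` A g l) w : R).
  by apply/funext => w; exact: stMw.
have iA2 k l : intg (\1_(A f k `&` A g l) : Omega -> R).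
  by apply: i1; apply: measurableI; exact: mA.
have istM : intg (fun w => st f w * st g w).
  rewrite stM; apply: integrableZl_EFin; apply: integrable_sum_EFin => k.
  by apply: integrable_sum_EFin => l; exact: iA2.
have EstM : \int[P]_w (st f w * st g w) = K%:R^-1 ^+ 2 *
    \sum_(k < K) \sum_(l < K) fine (P (A f k `&` A g l)).
  rewrite stM RintegralZl //; last first.
    by apply: integrable_sum_EFin => k; apply: integrable_sum_EFin => l; exact: iA2.
  rewrite Rintegral_sum; last first.
    by move=> k; apply: integrable_sum_EFin => l; exact: iA2.
  congr (_ * _); apply: eq_bigr => k _; rewrite Rintegral_sum //.
  by apply: eq_bigr => l _; rewrite Rintegral_indic //; apply: measurableI; exact: mA.
have covst : `|\int[P]_w (st f w * st g w) - \int[P]_w st f w * \int[P]_w st g w| <= delta.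
  rewrite EstM !Est // mulrACA -expr2 -mulrBr mulr_suml -sumrB.
  rewrite normrM ger0_norm ?exprn_ge0 ?invr_ge0 //.
  rewrite exprVn mulrC ler_pdivrMr ?exprn_gt0 //.
  apply: le_trans (ler_norm_sum _ _ _) _.
  apply: (@le_trans _ _ (\sum_(k < K) (delta * K%:R))); last first.
    by rewrite sumr_const card_ord -[leLHS]mulr_natr expr2 mulrA.
  apply: ler_sum => k _; rewrite mulr_sumr -sumrB.
  apply: le_trans (ler_norm_sum _ _ _) _.
  apply: (@le_trans _ _ (\sum_(l < K) delta)); last first.
    by rewrite sumr_const card_ord -[leLHS]mulr_natr.
  by apply: ler_sum => l _; exact: dP.
have itv (h : Omega -> R) : (forall w, 0 <= h w <= 1) -> forall w, `|h w| <= 1.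
  by move=> h01 w; have /andP[h0 h1] := h01 w; rewrite ger0_norm.
have itf : intg f by apply: integrable_bounded _ mf (itv _ f01).
have itg : intg g by apply: integrable_bounded _ mg (itv _ g01).
have stb (h : Omega -> R) w : (forall w, 0 <= h w <= 1) -> `|st h w| <= 1.
  by move=> h01; have [s0 s1 _] := step_count_approx (ltn0Sn _ : (0 < K)%N) (h01 w);
    rewrite ger0_norm.
have std (h : Omega -> R) w : (forall w, 0 <= h w <= 1) -> `|h w - st h w| <= K%:R^-1.
  by move=> h01; have [] := step_count_approx (ltn0Sn _ : (0 < K)%N) (h01 w).
have fb := itv _ f01; have gb := itv _ g01.
have prodB (a b a' b' : R) : `|a| <= 1 -> `|b'| <= 1 -> `|a - a'| <= K%:R^-1 ->
    `|b - b'| <= K%:R^-1 -> `|a * b - a' * b'| <= 2 / K%:R.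
  move=> a1 b1 aa bb; rewrite (_ : _ - _ = a * (b - b') + (a - a') * b'); last by ring.
  apply: le_trans (ler_normD _ _) _; rewrite !normrM mulrDl !mul1r.
  by apply: lerD; [rewrite -[leRHS]mul1r|rewrite -[leRHS]mulr1]; exact: ler_pM.
have d1 : `|\int[P]_w (f w * g w) - \int[P]_w (st f w * st g w)| <= 2 / K%:R.
  rewrite -[leRHS](Rintegral_prob_cst P); apply: le_norm_RintegralB => //.
  - apply: (@integrable_bounded _ _ _ _ _ 1); first exact: measurable_funM.
    by move=> w; rewrite normrM -[leRHS]mul1r ler_pM.
  - by apply: (@integrable_bounded _ _ _ _ _ `|2 / K%:R|) => // w.
  - by move=> w; apply: prodB => //; [exact: stb|exact: std|exact: std].
have dh (h : Omega -> R) : measurable_fun setT h -> (forall w, 0 <= h w <= 1) ->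
    `|\int[P]_w h w - \int[P]_w st h w| <= K%:R^-1.
  move=> mh h01; rewrite -[leRHS](Rintegral_prob_cst P).
  apply: le_norm_RintegralB => //.
  - exact: integrable_bounded _ mh (itv _ h01).
  - exact: ist.
  - by apply: (@integrable_bounded _ _ _ _ _ `|K%:R^-1|) => // w.
  - by move=> w; exact: std.
have d2 : `|\int[P]_w f w * \int[P]_w g w - \int[P]_w st f w * \int[P]_w st g w| <= 2 / K%:R.
  apply: prodB; [exact: le_norm_Rintegral| |exact: dh|exact: dh].
  by apply: le_norm_Rintegral; [exact: ist|move=> w; exact: stb].
apply: le_trans (_ : delta + 4 / K%:R <= _); last by rewrite lerD2l.
rewrite (_ : 4 / K%:R = 2 / K%:R + 2 / K%:R); last by rewrite -mulrDl -natrD.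
move: covst d1 d2; rewrite !ler_norml => /andP[? ?] /andP[? ?] /andP[? ?].
by apply/andP; split; lra.
Qed.

(** Covariance ignores shifts and is bilinear: the affine maps of [[-a, a]] and [[-b, b]] onto
    [[0, 1]] divide it by [2 a] and [2 b], and they send level sets to level sets. *)
Lemma cov_le_bounded f g (a b delta : R) :
    measurable_fun setT f -> measurable_fun setT g -> 0 < a -> 0 < b ->
    (forall w, `|f w| <= a) -> (forall w, `|g w| <= b) ->
    (forall s t : R, `|fine (P ([set w | s <= f w] `&` [set w | t <= g w])) -
       fine (P [set w | s <= f w]) * fine (P [set w | t <= g w])| <= delta) ->
  `|\int[P]_w (f w * g w) - \int[P]_w f w * \int[P]_w g w| <= 4 * delta * a * b.
Proof.
move=> mf mg a0 b0 fa gb dP.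
have itf : intg f by apply: integrable_bounded _ mf fa.
have itg : intg g by apply: integrable_bounded _ mg gb.
pose u (h : Omega -> R) c w := (h w + c) / (2 * c).
have uE (h : Omega -> R) (c : R) w : 0 < c -> h w = 2 * c * u h c w - c.
  by move=> c0; rewrite /u; field; rewrite gt_eqF.
have mu (h : Omega -> R) (c : R) : measurable_fun setT h -> measurable_fun setT (u h c).
  by move=> mh; apply: measurable_funM => //; apply: measurable_funD.
have u01 (h : Omega -> R) (c : R) : 0 < c -> (forall w, `|h w| <= c) -> forall w, 0 <= u h c w <= 1.
  move=> c0 hc w; have := hc w; rewrite ler_norml => /andP[h1 h2].
  have c2 : 0 < 2 * c by rewrite mulr_gt0.
  rewrite /u; apply/andP; split; first by rewrite divr_ge0 ?(ltW c2) //; lra.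
  by rewrite ler_pdivrMr //; lra.
have uset (h : Omega -> R) (c s : R) : 0 < c -> [set w | s <= u h c w] = [set w | 2 * c * s - c <= h w].
  move=> c0; apply/seteqP; split => w /=;
    by rewrite /u ler_pdivlMr ?mulr_gt0 // => ?; lra.
have itu (h : Omega -> R) (c : R) : measurable_fun setT h -> 0 < c -> (forall w, `|h w| <= c) -> intg (u h c).
  move=> mh c0 hc; apply: (@integrable_bounded _ _ _ _ _ 1); first exact: mu.
  by move=> w; have /andP[? ?] := u01 h c c0 hc w; rewrite ger0_norm.
have := @cov_le_unit (u f a) (u g b) delta (mu _ _ mf) (mu _ _ mg)
  (u01 _ _ a0 fa) (u01 _ _ b0 gb).
set U := u f a; set V := u g b => covUV.
have [iU iV] : intg U /\ intg V by split; exact: itu.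
have iUV : intg (fun w => U w * V w).
  apply: (@integrable_bounded _ _ _ _ _ 1).
    by apply: measurable_funM; exact: mu.
  move=> w; have /andP[? ?] := u01 f a a0 fa w; have /andP[? ?] := u01 g b b0 gb w.
  by rewrite normrM -[leRHS]mul1r ler_pM // ger0_norm.
have icst c : intg (fun=> c : R) by exact: (@integrable_bounded _ _ _ _ _ `|c|).
have aff (h : Omega -> R) (c e : R) : intg h -> \int[P]_w (c * h w + e) = c * \int[P]_w h w + e.
  move=> ih; rewrite RintegralD //; last exact: integrableZl_EFin.
  by rewrite RintegralZl // Rintegral_prob_cst.
have Ef : \int[P]_w f w = 2 * a * \int[P]_w U w + (- a).
  by rewrite -aff //; apply: eq_Rintegral => w _; exact: uE.
have Eg : \int[P]_w g w = 2 * b * \int[P]_w V w + (- b).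
  by rewrite -aff //; apply: eq_Rintegral => w _; exact: uE.
have Efg : \int[P]_w (f w * g w) = 4 * a * b * \int[P]_w (U w * V w) +
    (- 2 * a * b * \int[P]_w U w + (- 2 * a * b * \int[P]_w V w + a * b)).
  rewrite -[X in _ = _ + (_ + X)]aff // -RintegralZl // -RintegralZl // -!RintegralD //.
  - by apply: eq_Rintegral => w _; rewrite (uE f a) // (uE g b) // -/U -/V; ring.
  - exact: integrableZl_EFin.
  - apply: integrableD_EFin; first exact: integrableZl_EFin.
    by apply: integrableD_EFin => //; exact: integrableZl_EFin.
  - exact: integrableZl_EFin.
  - by apply: integrableD_EFin => //; exact: integrableZl_EFin.
rewrite (_ : _ - _ = 4 * a * b *
  (\int[P]_w (U w * V w) - \int[P]_w U w * \int[P]_w V w)); last first.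
  by rewrite Efg Ef Eg; ring.
have ab0 : 0 <= 4 * a * b by rewrite !mulr_ge0 // ltW.
rewrite normrM ger0_norm // (_ : 4 * delta * a * b = 4 * a * b * delta); last by ring.
apply: ler_wpM2l => //; apply: covUV => s t.
by rewrite !uset //; exact: dP.
Qed.

End BoundedCovariance.

(** * Truncated moments *)

Section Truncation.
Context {R : realType}.

(** Setting large values to 0, instead of clipping them at [H], makes a product vanish as soon as
    one factor exceeds [H]. *)
Definition truncate (H x : R) : R := if `|x| <= H then x else 0.

Definition tail_pow (N : nat) (H x : R) : R := if `|x| <= H then 0 else `|x| ^+ N.

Lemma truncate_le H x : 0 <= H -> `|truncate H x| <= H.
Proof. by rewrite /truncate; case: ifP => // _; rewrite normr0. Qed.

Lemma truncate_le_norm H x : `|truncate H x| <= `|x|.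
Proof. by rewrite /truncate; case: ifP => // _; rewrite normr0. Qed.

Lemma tail_pow_ge0 N H x : 0 <= tail_pow N H x.
Proof. by rewrite /tail_pow; case: ifP => // _; rewrite exprn_ge0. Qed.

Lemma measurable_truncate H : measurable_fun setT (truncate H).
Proof.
apply: measurable_fun_ifT => //.
by apply: measurable_fun_ler => //; exact: measurableT_comp.
Qed.

Lemma measurable_tail_pow N H : measurable_fun setT (tail_pow N H).
Proof.
apply: measurable_fun_ifT => //.
  exact: measurable_fun_ler.
exact: measurable_funX.
Qed.

Context {I : eqType}.
Implicit Types (s : seq I) (x : I -> R).

Lemma norm_prod_le s x (z : R) N :
    1 <= z -> (size s <= N)%N -> (forall i, i \in s -> `|x i| <= z) ->
  `|\prod_(i <- s) x i| <= z ^+ N.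
Proof.
move=> z1 sN xz; apply: (@le_trans _ _ (z ^+ size s)); last exact: ler_weXn2l.
elim: s {sN} xz => [|i s IHs] xz; first by rewrite big_nil normr1 expr0.
rewrite big_cons exprS normrM ler_pM // ?xz ?mem_head //.
by apply: IHs => j js; rewrite xz // in_cons js orbT.
Qed.

Lemma exists_max_norm s x : s != [::] ->
  exists2 i, i \in s & forall j, j \in s -> `|x j| <= `|x i|.
Proof.
elim: s => // i [|j s] IHs _; first by exists i; rewrite ?mem_head // => k; rewrite in_cons orbF => /eqP ->.
have [//|k ks kmax] := IHs; have [ik|ki] := leP `|x i| `|x k|.
  by exists k => [|l]; rewrite in_cons ?ks ?orbT // => /predU1P [->//|/kmax].
exists i => [|l]; rewrite in_cons ?eqxx // => /predU1P [->//|/kmax /le_trans].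
by apply; exact: ltW.
Qed.

Lemma le_sum_mem s (y : I -> R) i : (forall j, 0 <= y j) -> i \in s ->
  y i <= \sum_(j <- s) y j.
Proof. by move=> y0 si; rewrite (big_rem i) //= lerDl sumr_ge0. Qed.

(** A pointwise substitute for Hölder's inequality: if the largest factor exceeds 1, its [N]-th
    power dominates the product; otherwise the product is at most 1. *)
Lemma norm_prod_le_sum s x N : (size s <= N)%N ->
  `|\prod_(i <- s) x i| <= 1 + \sum_(i <- s) `|x i| ^+ N.
Proof.
move=> sN; have [->|s0] := eqVneq s [::]; first by rewrite !big_nil normr1 addr0.
have [i si imax] := exists_max_norm x s0.
have S0 : 0 <= \sum_(i <- s) `|x i| ^+ N by rewrite sumr_ge0.
have [x1|/ltW x1] := leP `|x i| 1.
  apply: (@le_trans _ _ (1 ^+ N)); last by rewrite expr1n lerDl.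
  by apply: norm_prod_le => // j /imax /le_trans; exact.
apply: le_trans (norm_prod_le x1 sN imax) _.
apply: (@le_trans _ _ (\sum_(i <- s) `|x i| ^+ N)); last by rewrite lerDr.
exact: (@le_sum_mem s (fun j => `|x j| ^+ N)).
Qed.

(** Either no factor exceeds [H] and the products agree, or the truncated product is 0 and the
    largest factor, which exceeds [H >= 1], dominates the other product by its own tail term. *)
Lemma norm_prod_truncate s x N H : 1 <= H -> (size s <= N)%N ->
  `|\prod_(i <- s) x i - \prod_(i <- s) truncate H (x i)| <=
  \sum_(i <- s) tail_pow N H (x i).
Proof.
move=> H1 sN; have S0 : 0 <= \sum_(i <- s) tail_pow N H (x i).
  by rewrite sumr_ge0 // => i _; exact: tail_pow_ge0.
case: (boolP (all (fun i => `|x i| <= H) s)) => [/allP xH|/allPn [i0 si0 xi0]].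
  rewrite [X in _ - X](_ : _ = \prod_(i <- s) x i) ?subrr ?normr0 //.
  by rewrite big_seq [RHS]big_seq; apply: eq_bigr => i /xH; rewrite /truncate => ->.
rewrite [X in _ - X](_ : _ = 0) ?subr0; last first.
  by apply/eqP; rewrite (big_rem i0) //= /truncate (negPf xi0) mul0r.
have [|i si imax] := @exists_max_norm s x; first by case: (s) si0.
have Hi : H < `|x i| by rewrite (lt_le_trans _ (imax _ si0)) // ltNge.
apply: le_trans (norm_prod_le (le_trans H1 (ltW Hi)) sN imax) _.
apply: le_trans (le_sum_mem (fun j => tail_pow_ge0 N H (x j)) si).
by rewrite /tail_pow (lt_geF Hi).
Qed.

End Truncation.

Section Moments.
Context {R : realType} {d : measure_display} {Omega : measurableType d}.
Variable P : probability Omega R.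
Context {I : eqType}.
Variable X : I -> Omega -> R.
Hypothesis mX : forall i, measurable_fun setT (X i).
Implicit Types (s u : seq I).

Local Notation intg f := (P.-integrable setT (EFin \o f)).

Definition moment s : R := \int[P]_w \prod_(i <- s) X i w.
Definition trunc_moment H s : R := \int[P]_w \prod_(i <- s) truncate H (X i w).

Lemma moment_nil : moment [::] = 1.
Proof.
rewrite /moment -[RHS](Rintegral_prob_cst P); apply: eq_Rintegral => w _.
by rewrite big_nil.
Qed.

Variables (N : nat) (B : R).

(** Integrability is stated separately because the real-valued integral reads an infinite value as
    0. *)
Definition moment_le i := intg (fun w => `|X i w| ^+ N) /\
  \int[P]_w `|X i w| ^+ N <= B.

Lemma measurable_prodX s : measurable_fun setT (fun w => \prod_(i <- s) X i w).
Proof. exact: measurable_prod. Qed.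

Lemma measurable_prod_truncate H s :
  measurable_fun setT (fun w => \prod_(i <- s) truncate H (X i w)).
Proof.
apply: measurable_prod => i _; exact: measurableT_comp (measurable_truncate H) (mX i).
Qed.

Lemma integrable_sum_seq s (F : I -> Omega -> R) :
  (forall i, i \in s -> intg (F i)) -> intg (fun w => \sum_(i <- s) F i w).
Proof.
move=> iF; rewrite (_ : (fun _ => _) =
    fun w => \sum_(i <- s) (if i \in s then F i w else 0)).
  apply: integrable_sum_EFin => i; case: (boolP (i \in s)) => [/iF //|_].
  by apply: (@integrable_bounded _ _ _ _ _ 0) => // w; rewrite normr0.
by apply/funext => w; rewrite big_seq [RHS]big_seq; apply: eq_bigr => i ->.
Qed.

Lemma le_Rintegral_sum_seq s (F : I -> Omega -> R) (c : R) :
    (forall i, i \in s -> intg (F i) /\ \int[P]_w F i w <= c) ->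
  \int[P]_w (\sum_(i <- s) F i w) <= (size s)%:R * c.
Proof.
elim: s => [|i s IHs] iF.
  rewrite mul0r; under eq_Rintegral do rewrite big_nil.
  by rewrite Rintegral_prob_cst.
have iFs j : j \in s -> intg (F j) /\ \int[P]_w F j w <= c.
  by move=> js; apply: iF; rewrite in_cons js orbT.
under eq_Rintegral do rewrite big_cons.
have [iFi leFi] := iF i (mem_head _ _).
rewrite RintegralD //; last by apply: integrable_sum_seq => j /iFs [].
by rewrite /= -natr1 mulrDl mul1r addrC lerD // IHs.
Qed.

Lemma integrable_prodX s : (size s <= N)%N -> (forall i, i \in s -> moment_le i) ->
  intg (fun w => \prod_(i <- s) X i w).
Proof.
move=> sN sB; apply: (@integrable_dominated _ _ _ _ _
    (fun w => 1 + \sum_(i <- s) `|X i w| ^+ N)).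
- exact: measurable_prodX.
- apply: integrableD_EFin.
    by apply: (@integrable_bounded _ _ _ _ _ 1) => // w; rewrite normr1.
  by apply: integrable_sum_seq => i /sB [].
- by move=> w; exact: norm_prod_le_sum.
Qed.

Lemma integrable_prod_truncate H s : 0 <= H ->
  intg (fun w => \prod_(i <- s) truncate H (X i w)).
Proof.
move=> H0; apply: (@integrable_bounded _ _ _ _ _ ((1 + H) ^+ size s)).
  exact: measurable_prod_truncate.
move=> w; apply: norm_prod_le => //; first by rewrite lerDl.
by move=> i _; rewrite (le_trans (truncate_le _ H0)) // lerDr.
Qed.

Lemma norm_moment_le s : 0 <= B -> (size s <= N)%N -> (forall i, i \in s -> moment_le i) ->
  `|moment s| <= 1 + N%:R * B.
Proof.
move=> B0 sN sB.
have iS : intg (fun w => \sum_(i <- s) `|X i w| ^+ N).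
  by apply: integrable_sum_seq => i /sB [].
have i1 : intg (fun=> 1 : R).
  by apply: (@integrable_bounded _ _ _ _ _ 1) => // w; rewrite normr1.
have ip := integrable_prodX sN sB.
rewrite /moment; apply: le_trans (le_normr_Rintegral measurableT ip) _.
apply: (@le_trans _ _ (\int[P]_w (1 + \sum_(i <- s) `|X i w| ^+ N))).
  apply: le_Rintegral => //; first exact: integrable_norm.
    exact: integrableD_EFin.
  by move=> w _; exact: norm_prod_le_sum.
rewrite RintegralD // Rintegral_prob_cst lerD2l.
apply: le_trans (_ : (size s)%:R * B <= _); last by rewrite ler_wpM2r // ler_nat.
exact: le_Rintegral_sum_seq.
Qed.

Lemma norm_trunc_moment_le H s : 0 <= H -> 0 <= B -> (size s <= N)%N ->
  (forall i, i \in s -> moment_le i) -> `|trunc_moment H s| <= 1 + N%:R * B.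
Proof.
move=> H0 B0 sN sB.
have iS : intg (fun w => \sum_(i <- s) `|X i w| ^+ N).
  by apply: integrable_sum_seq => i /sB [].
have i1 : intg (fun=> 1 : R).
  by apply: (@integrable_bounded _ _ _ _ _ 1) => // w; rewrite normr1.
have ip := integrable_prod_truncate s H0.
rewrite /trunc_moment; apply: le_trans (le_normr_Rintegral measurableT ip) _.
apply: (@le_trans _ _ (\int[P]_w (1 + \sum_(i <- s) `|X i w| ^+ N))).
  apply: le_Rintegral => //; first exact: integrable_norm.
    exact: integrableD_EFin.
  move=> w _; apply: le_trans (norm_prod_le_sum _ sN) _; rewrite lerD2l.
  apply: ler_sum => i _; rewrite lerXn2r ?nnegrE //; exact: truncate_le_norm.
rewrite RintegralD // Rintegral_prob_cst lerD2l.
apply: le_trans (_ : (size s)%:R * B <= _); last by rewrite ler_wpM2r // ler_nat.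
exact: le_Rintegral_sum_seq.
Qed.

Lemma moment_truncate H (tau : R) s : 1 <= H -> 0 <= tau -> (size s <= N)%N ->
    (forall i, i \in s -> moment_le i) ->
    (forall i, i \in s -> \int[P]_w tail_pow N H (X i w) <= tau) ->
  `|moment s - trunc_moment H s| <= N%:R * tau.
Proof.
move=> H1 tau0 sN sB sT; have H0 : 0 <= H by rewrite (le_trans _ H1).
have iT i : i \in s -> intg (fun w => tail_pow N H (X i w)).
  move=> /sB [iXN _]; apply: integrable_dominated iXN _.
    exact: measurableT_comp (measurable_tail_pow N H) (mX i).
  move=> w; rewrite ger0_norm ?tail_pow_ge0 // /tail_pow.
  by case: ifP => // _; rewrite exprn_ge0.
have iS : intg (fun w => \sum_(i <- s) tail_pow N H (X i w)).
  by apply: integrable_sum_seq => i /iT.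
apply: (@le_trans _ _ (\int[P]_w (\sum_(i <- s) tail_pow N H (X i w)))).
  apply: le_norm_RintegralB => //.
  - exact: integrable_prodX.
  - exact: integrable_prod_truncate.
  - by move=> w; exact: norm_prod_truncate.
apply: le_trans (_ : (size s)%:R * tau <= _); last by rewrite ler_wpM2r // ler_nat.
by apply: le_Rintegral_sum_seq => i si; split; [exact: iT|exact: sT].
Qed.

(** Only the truncated products are bounded, so the covariance inequality is applied to them,
    through their level sets; the passage between moments and truncated moments is paid by the
    tails. The level [H] stays free, to be balanced later. *)
Lemma moment_split (a : pred I) H (tau delta : R) s :
    1 <= H -> 0 <= B -> 0 <= tau -> 0 <= delta -> (size s <= N)%N ->
    (forall i, i \in s -> moment_le i) ->
    (forall i, i \in s -> \int[P]_w tail_pow N H (X i w) <= tau) ->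
    (forall b c : R,
      let E := [set w | b <= \prod_(i <- seq.filter a s) truncate H (X i w)] in
      let F := [set w | c <= \prod_(i <- seq.filter (predC a) s) truncate H (X i w)] in
      `|fine (P (E `&` F)) - fine (P E) * fine (P F)| <= delta) ->
  `|moment s - moment (seq.filter a s) * moment (seq.filter (predC a) s)| <=
  4 * delta * H ^+ N + (3 + 2 * N%:R * B) * (N%:R * tau).
Proof.
move=> H1 B0 tau0 delta0 sN sB sT dP; have H0 : 0 <= H by rewrite (le_trans _ H1).
set s1 := seq.filter a s; set s2 := seq.filter (predC a) s.
have sub1 i : i \in s1 -> i \in s by rewrite mem_filter => /andP[].
have sub2 i : i \in s2 -> i \in s by rewrite mem_filter => /andP[].
have size12 : (size s1 + size s2)%N = size s by rewrite !size_filter count_predC.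
have s1N : (size s1 <= N)%N by rewrite (leq_trans _ sN) // -size12 leq_addr.
have s2N : (size s2 <= N)%N by rewrite (leq_trans _ sN) // -size12 leq_addl.
have B1 i : i \in s1 -> moment_le i by move=> /sub1 /sB.
have B2 i : i \in s2 -> moment_le i by move=> /sub2 /sB.
have T1 i : i \in s1 -> \int[P]_w tail_pow N H (X i w) <= tau by move=> /sub1 /sT.
have T2 i : i \in s2 -> \int[P]_w tail_pow N H (X i w) <= tau by move=> /sub2 /sT.
have prodE H' w : \prod_(i <- s) truncate H' (X i w) =
    (\prod_(i <- s1) truncate H' (X i w)) * \prod_(i <- s2) truncate H' (X i w).
  by rewrite /s1 /s2 !big_filter (bigID a).
have H0' : 0 < H by rewrite (lt_le_trans _ H1).
have bnd s' w : `|\prod_(i <- s') truncate H (X i w)| <= H ^+ size s'.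
  by apply: norm_prod_le => // i _; exact: truncate_le.
have covT : `|trunc_moment H s - trunc_moment H s1 * trunc_moment H s2| <= 4 * delta * H ^+ N.
  apply: (@le_trans _ _ (4 * delta * H ^+ size s1 * H ^+ size s2)).
    rewrite [X in `|X - _|](_ : _ = \int[P]_w
      ((\prod_(i <- s1) truncate H (X i w)) * \prod_(i <- s2) truncate H (X i w))).
      apply: cov_le_bounded; rewrite ?exprn_gt0 //; exact: measurable_prod_truncate.
    by apply: eq_Rintegral => w _; exact: prodE.
  rewrite -mulrA -exprD size12 ler_wpM2l ?mulr_ge0 //.
  exact: ler_weXn2l.
have d0 := moment_truncate H1 tau0 sN sB sT.
have d1 := moment_truncate H1 tau0 s1N B1 T1.
have d2 := moment_truncate H1 tau0 s2N B2 T2.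
have m1 := norm_moment_le B0 s1N B1.
have m2 := norm_trunc_moment_le H0 B0 s2N B2.
(* The coefficient [3 + 2 * N%:R * B] is [1 + 2 * (1 + N%:R * B)]: one truncation error for [s], and
   one for each group times the moment bound of the other group. *)
rewrite (_ : moment s - _ = (moment s - trunc_moment H s) +
  (trunc_moment H s - trunc_moment H s1 * trunc_moment H s2) -
  (moment s1 * (moment s2 - trunc_moment H s2) +
   (moment s1 - trunc_moment H s1) * trunc_moment H s2)); last by ring.
set t := N%:R * tau in d0 d1 d2 *.
have t0 : 0 <= t by rewrite mulr_ge0.
have e1 : `|moment s1 * (moment s2 - trunc_moment H s2)| <= (1 + N%:R * B) * t.
  by rewrite normrM ler_pM.
have e2 : `|(moment s1 - trunc_moment H s1) * trunc_moment H s2| <= (1 + N%:R * B) * t.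
  by rewrite normrM mulrC ler_pM.
apply: le_trans (ler_normB _ _) _.
apply: le_trans (lerD (ler_normD _ _) (ler_normD _ _)) _.
rewrite (_ : (3 + 2 * N%:R * B) * t = t + ((1 + N%:R * B) * t + (1 + N%:R * B) * t)).
  by lra.
by ring.
Qed.

End Moments.

(** * Mixing coefficients *)

Section Mixing.
Context {R : realType} {disp : measure_display} {Omega : measurableType disp}.
Variable P : probability Omega R.
Variables (d : nat) (X : 'rV[int]_d -> {RV P >-> R}).
Implicit Types (U T : {fset 'rV[int]_d}) (E F : set Omega).

Lemma sigma_field_measurable U E : sigma_field X U E -> measurable E.
Proof.
apply: smallest_sub E; first exact: sigma_algebra_measurable.
move=> E [i _ [A mA <-]]; exact: (measurable_funPT (X i)).
Qed.

Lemma sigma_field_level_prod_truncate U (s : seq 'rV[int]_d) H (b : R) :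
  {subset s <= U} ->
  sigma_field X U [set w | b <= \prod_(i <- s) truncate H (X i w)].
Proof.
move=> sU; rewrite /sigma_field; set G := \bigcup_(i in _) _.
(* Equipping the sample space with the generated sigma-algebra turns membership in [sigma_field X U]
   into ordinary measurability. *)
have mX i : i \in s -> measurable_fun setT (X i : g_sigma_algebraType G -> R).
  move=> /sU iU _ A mA; apply: sub_sigma_algebra.
  by exists i => //; exists A.
have mp : measurable_fun setT
    (fun w : g_sigma_algebraType G => \prod_(i <- s) truncate H (X i w)).
  apply: measurable_prod => i si.
  exact: measurableT_comp (measurable_truncate H) (mX i si).
have := measurable_fun_le measurableT (measurable_cst b) mp.
by rewrite setTI.
Qed.

(** This crude bound makes the suprema in [alpha_mixing] and [alpha_coef] genuine: [sup] takes a
    default value on a set that is not bounded above. *)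
Lemma dependence_le1 E F : measurable E -> measurable F ->
  `|fine (P (E `&` F)) - fine (P E) * fine (P F)| <= 1.
Proof.
move=> mE mF.
have p01 A : measurable A -> 0 <= fine (P A) <= 1.
  move=> mA; rewrite fine_ge0 //= -lee_fin fineK; last exact: fin_num_measure.
  exact: probability_le1.
have /andP[? ?] := p01 _ mE; have /andP[? ?] := p01 _ mF.
have /andP[? ?] := p01 _ (measurableI _ _ mE mF).
by rewrite ler_norml; nra.
Qed.

Let dependence_set (A B : set (set Omega)) := [set x : R | exists E F : set Omega,
  [/\ A E, B F & x = `|fine (P (E `&` F)) - fine (P E) * fine (P F)|]].

Lemma alpha_mixing_has_sup U1 U2 :
  has_sup (dependence_set (sigma_field X U1) (sigma_field X U2)).
Proof.
split.
  exists `|fine (P (set0 `&` set0)) - fine (P set0) * fine (P set0)|.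
  by exists set0, set0; split => //; exact: sigma_algebra0.
exists 1 => x [E [F [/sigma_field_measurable mE /sigma_field_measurable mF ->]]].
exact: dependence_le1.
Qed.

Lemma alpha_mixing_ge U1 U2 E F : sigma_field X U1 E -> sigma_field X U2 F ->
  `|fine (P (E `&` F)) - fine (P E) * fine (P F)| <=
  alpha_mixing P (sigma_field X U1) (sigma_field X U2).
Proof.
move=> sE sF; apply: sup_upper_bound; first exact: alpha_mixing_has_sup.
by exists E, F.
Qed.

Lemma alpha_mixing_le1 U1 U2 :
  alpha_mixing P (sigma_field X U1) (sigma_field X U2) <= 1.
Proof.
apply: ge_sup; first by have [] := alpha_mixing_has_sup U1 U2.
move=> x [E [F [/sigma_field_measurable mE /sigma_field_measurable mF ->]]].
exact: dependence_le1.
Qed.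

Let coef_set T (q l : nat) := [set x : R | exists U1 U2 : {fset 'rV[int]_d},
  [/\ (U1 `<=` T)%fset, (U2 `<=` T)%fset, (#|` U1| <= q)%N, set_dist_ge l U1 U2 &
      x = alpha_mixing P (sigma_field X U1) (sigma_field X U2)]].

Lemma alpha_coef_has_sup T q l : has_sup (coef_set T q l).
Proof.
split.
  (* Two empty groups satisfy every distance constraint, so the set is nonempty even if no two sites
     of [T] are [l] apart. *)
  exists (alpha_mixing P (sigma_field X fset0) (sigma_field X fset0)).
  exists fset0, fset0; split; rewrite ?cardfs0 ?fsub0set //.
by exists 1 => x [U1 [U2 [_ _ _ _ ->]]]; exact: alpha_mixing_le1.
Qed.

Lemma alpha_coef_ge T q l (U1 U2 : {fset 'rV[int]_d}) :
    (U1 `<=` T)%fset -> (U2 `<=` T)%fset -> (#|` U1| <= q)%N -> set_dist_ge l U1 U2 ->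
  alpha_mixing P (sigma_field X U1) (sigma_field X U2) <= alpha_coef X T q l.
Proof.
move=> U1T U2T U1q U12; rewrite /alpha_coef le_max; apply/orP; right.
apply: sup_upper_bound; first exact: alpha_coef_has_sup.
by exists U1, U2.
Qed.

Lemma alpha_coef_ge0 T q l : 0 <= alpha_coef X T q l.
Proof. by rewrite /alpha_coef le_max lexx. Qed.

Lemma alpha_coef_le1 T q l : alpha_coef X T q l <= 1.
Proof.
rewrite /alpha_coef ge_max ler01 /=.
apply: ge_sup; first by have [] := alpha_coef_has_sup T q l.
by move=> x [U1 [U2 [_ _ _ _ ->]]]; exact: alpha_mixing_le1.
Qed.

Lemma le_alpha_coef T q (l l' : nat) : (l <= l')%N ->
  alpha_coef X T q l' <= alpha_coef X T q l.
Proof.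
move=> ll'; rewrite {1}/alpha_coef ge_max alpha_coef_ge0 /=.
apply: ge_sup; first by have [] := alpha_coef_has_sup T q l'.
move=> x [U1 [U2 [U1T U2T U1q U12 ->]]]; apply: alpha_coef_ge => // i j iU jU.
by apply: le_trans (U12 _ _ iU jU); rewrite lez_nat.
Qed.

End Mixing.

(** * Moments and tails from a bound on the norm *)

Section NormBounds.
Context {R : realType} {d : measure_display} {Omega : measurableType d}.
Variable P : probability Omega R.
Variable f : Omega -> R.
Hypothesis mf : measurable_fun setT f.

Local Notation intg f := (P.-integrable setT (EFin \o f)).

Lemma integrable_powR_Lnorm (r K : R) : 0 < r -> 0 <= K ->
    ('N[P]_r%:E[EFin \o f] <= K%:E)%E ->
  intg (fun w => `|f w| `^ r) /\ \int[P]_w `|f w| `^ r <= K `^ r.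
Proof.
move=> r0 K0 fK.
have leI : (\int[P]_w (`|f w| `^ r)%:E <= (K `^ r)%:E)%E.
  rewrite -poweR_EFin; have := @powR_Lnorm _ _ _ P (EFin \o f) r (lt0r_neq0 r0).
  have -> : (\int[P]_w (`|(EFin \o f) w| `^ r) = \int[P]_w (`|f w| `^ r)%:E)%E by [].
  move=> <-; apply: gt0_ler_poweR (ltW r0) _ _ _ _ fK.
    by rewrite in_itv /= Lnorm_ge0 leey.
  by rewrite in_itv /= lee_fin K0 leey.
have mp : measurable_fun setT (fun w => `|f w| `^ r).
  by apply: (measurableT_comp (measurable_powR r)); exact: measurableT_comp.
have ip : intg (fun w => `|f w| `^ r).
  apply/integrableP; split; first exact/measurable_EFinP.
  apply: le_lt_trans (ltry (K `^ r)); apply: le_trans leI.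
  by under eq_integral => w _ do rewrite /= ger0_norm ?powR_ge0 //.
split=> //; rewrite /Rintegral -lee_fin fineK //.
exact: integrable_fin_num.
Qed.

Lemma moment_le_Lnorm (r K : R) (N : nat) : N%:R < r -> 0 <= K ->
    ('N[P]_r%:E[EFin \o f] <= K%:E)%E ->
  intg (fun w => `|f w| ^+ N) /\ \int[P]_w `|f w| ^+ N <= 1 + K `^ r.
Proof.
move=> Nr K0 fK; have r0 : 0 < r by rewrite (le_lt_trans _ Nr).
have [ip leip] := integrable_powR_Lnorm r0 K0 fK.
have i1 : intg (fun=> 1 : R).
  by apply: (@integrable_bounded _ _ _ _ _ 1) => // w; rewrite normr1.
have lef w : `|f w| ^+ N <= 1 + `|f w| `^ r.
  have [f1|/ltW f1] := leP `|f w| 1.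
    by rewrite (le_trans (exprn_ile1 _ (normr_ge0 _) f1)) // lerDl powR_ge0.
  by rewrite -powR_mulrn // (le_trans (ler_powR f1 (ltW Nr))) // lerDr.
have iN : intg (fun w => `|f w| ^+ N).
  apply: (integrable_dominated _ (integrableD_EFin i1 ip)).
    by apply: measurable_funX; exact: measurableT_comp.
  by move=> w; rewrite ger0_norm ?exprn_ge0.
split=> //; apply: (@le_trans _ _ (\int[P]_w (1 + `|f w| `^ r))).
  by apply: le_Rintegral => //; exact: integrableD_EFin.
by rewrite RintegralD // Rintegral_prob_cst lerD2l.
Qed.

(** Where [|f| > H], the negative exponent [N - r] gives [|f|^N = |f|^(N - r) |f|^r <= H^(N - r)
    |f|^r]. *)
Lemma tail_le_Lnorm (r K H : R) (N : nat) : N%:R < r -> 0 <= K -> 1 <= H ->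
    ('N[P]_r%:E[EFin \o f] <= K%:E)%E ->
  \int[P]_w tail_pow N H (f w) <= H `^ (N%:R - r) * K `^ r.
Proof.
move=> Nr K0 H1 fK; have r0 : 0 < r by rewrite (le_lt_trans _ Nr).
have [ip leip] := integrable_powR_Lnorm r0 K0 fK.
have H0 : 0 < H by rewrite (lt_le_trans _ H1).
have tailw w : tail_pow N H (f w) <= H `^ (N%:R - r) * `|f w| `^ r.
  rewrite /tail_pow; case: (leP `|f w| H) => [_|Hf]; first by rewrite mulr_ge0 ?powR_ge0.
  have f0 : 0 < `|f w| by rewrite (lt_trans _ Hf).
  rewrite -powR_mulrn // -{1}(subrK r N%:R) powRD ?(gt_eqF f0) ?implybT //.
  rewrite ler_wpM2r ?powR_ge0 // -(opprB r) !powRN lef_pV2 ?posrE ?powR_gt0 //.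
  by rewrite ge0_ler_powR ?nnegrE ?subr_ge0 ?(ltW Nr) ?(ltW H0) ?(ltW Hf).
have iZ := integrableZl_EFin (H `^ (N%:R - r)) ip.
apply: (@le_trans _ _ (\int[P]_w (H `^ (N%:R - r) * `|f w| `^ r))).
  apply: le_Rintegral => //; apply: (integrable_dominated _ iZ).
    exact: measurableT_comp (measurable_tail_pow N H) mf.
  by move=> w; rewrite ger0_norm ?tail_pow_ge0.
by rewrite RintegralZl // ler_wpM2l ?powR_ge0.
Qed.

Lemma tail_Linfty (K : R) (N : nat) : ('N[P]_+oo[EFin \o f] <= K%:E)%E ->
  intg (fun w => tail_pow N K (f w)) /\ \int[P]_w tail_pow N K (f w) = 0.
Proof.
(* The norm of order [+oo] is an essential supremum only on a space of positive measure. *)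
have PT : (0 < P setT)%E by rewrite probability_setT lte01.
rewrite unlock; case: ifPn => [_ /ess_supP fK|/negP []]; last exact: PT.
have mt : measurable_fun setT (fun w => tail_pow N K (f w)).
  exact: measurableT_comp (measurable_tail_pow N K) mf.
have e0 : (\int[P]_w (tail_pow N K (f w))%:E = 0)%E.
  rewrite -[RHS](integral0 P setT); apply: ae_eq_integral => //.
    exact/measurable_EFinP.
  apply: filterS fK => w /=; rewrite lee_fin => fwK _.
  by rewrite /tail_pow fwK.
split; last by rewrite /Rintegral e0.
apply/integrableP; split; first exact/measurable_EFinP.
under eq_integral => w _ do rewrite /= ger0_norm ?tail_pow_ge0 //.
by rewrite e0.
Qed.

Lemma moment_le_Linfty (K : R) (N : nat) : 0 <= K ->
    ('N[P]_+oo[EFin \o f] <= K%:E)%E ->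
  intg (fun w => `|f w| ^+ N) /\ \int[P]_w `|f w| ^+ N <= K ^+ N.
Proof.
move=> K0 fK; have [it t0] := tail_Linfty N fK.
pose g w := if `|f w| <= K then `|f w| ^+ N else 0.
have mg : measurable_fun setT g.
  apply: measurable_fun_ifT => //.
    by apply: measurable_fun_ler => //; exact: measurableT_comp.
  by apply: measurable_funX; exact: measurableT_comp.
have gK w : `|g w| <= K ^+ N.
  rewrite /g; case: (leP `|f w| K) => [fwK|_]; last by rewrite normr0 exprn_ge0.
  by rewrite ger0_norm ?exprn_ge0 // lerXn2r ?nnegrE.
have ig := integrable_bounded P mg gK.
have fE w : `|f w| ^+ N = g w + tail_pow N K (f w).
  by rewrite /g /tail_pow; case: (leP `|f w| K); rewrite ?addr0 ?add0r.
rewrite (_ : (fun w => `|f w| ^+ N) = (fun w => g w + tail_pow N K (f w))); last first.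
  exact/funext.
split; first exact: integrableD_EFin.
rewrite RintegralD // t0 addr0; apply: le_trans (ler_norm _) _.
exact: le_norm_Rintegral.
Qed.

End NormBounds.

Lemma powR_le1 (R : realType) (x t : R) : 0 <= x <= 1 -> 0 <= t -> x `^ t <= 1.
Proof.
move=> /andP[x0 x1] t0; have := ge0_ler_powR t0 _ _ x1.
by rewrite powR1; apply; rewrite nnegrE.
Qed.

(** [C] is fixed by [N], [r] and [K] before any probability space is given. The dependence bound is
    required at every level [H] because the level is chosen from [delta] inside the proof. *)
Lemma moment_cov (R : realType) (N : nat) (r : \bar R) (K : R) :
    (N%:R%:E < r)%E -> 1 <= K ->
  exists2 C, 0 <= C &
    forall (d : measure_display) (Omega : measurableType d) (P : probability Omega R)
      (I : eqType) (X : I -> Omega -> R) (s : seq I),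
      (forall i, measurable_fun setT (X i)) -> (size s <= N)%N ->
      (forall i, i \in s -> ('N[P]_r[EFin \o X i] <= K%:E)%E) ->
    `|moment P X s| <= C /\
    (forall (a : pred I) (delta : R), 0 <= delta <= 1 ->
      (forall H b c : R,
        let E := [set w | b <= \prod_(i <- seq.filter a s) truncate H (X i w)] in
        let F := [set w | c <= \prod_(i <- seq.filter (predC a) s) truncate H (X i w)] in
        `|fine (P (E `&` F)) - fine (P E) * fine (P F)| <= delta) ->
      `|moment P X s - moment P X (seq.filter a s) * moment P X (seq.filter (predC a) s)|
        <= C * delta `^ ratio_exp r N%:R).
Proof.
move=> Nr K1; have K0 : 0 <= K := le_trans ler01 K1.
case: r Nr => [r|_|//]; last first.
  (* For [r = +oo], truncation at [K] itself discards only a null set: the tail term is 0, nothing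
     has to be balanced, and the bound is linear in [delta]. *)
  pose B := K ^+ N; have B0 : 0 <= B by rewrite exprn_ge0.
  exists (1 + N%:R * B + 4 * B) => [|d Omega P I X s mX sN sK].
    by rewrite !addr_ge0 ?mulr_ge0.
  have sB i : i \in s -> moment_le P X N B i by move=> /sK; exact: moment_le_Linfty.
  split.
    apply: le_trans (norm_moment_le mX B0 sN sB) _.
    by rewrite lerDl mulr_ge0.
  move=> a delta /andP[delta0 _] dP; rewrite /= powRr1 //.
  have sT i : i \in s -> \int[P]_w tail_pow N K (X i w) <= 0.
    by move=> /sK /(tail_Linfty (mX i) N) [_ ->].
  apply: le_trans (moment_split mX K1 B0 (lexx 0) delta0 sN sB sT (dP K)) _.
  rewrite !mulr0 addr0 -/B mulrAC ler_wpM2r // lerDr addr_ge0 ?mulr_ge0 //.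
rewrite lte_fin => Nr; have r0 : 0 < r by rewrite (le_lt_trans _ Nr).
pose B := 1 + K `^ r; have B0 : 0 <= B by rewrite addr_ge0 ?powR_ge0.
pose C := 4 + (3 + 2 * N%:R * B) * (N%:R * K `^ r).
have C4 : 4 <= C.
  by rewrite lerDl !mulr_ge0 ?addr_ge0 ?mulr_ge0 ?powR_ge0.
have C0 : 0 < C by rewrite (lt_le_trans _ C4).
exists (1 + N%:R * B + C) => [|d Omega P I X s mX sN sK].
  by apply: addr_ge0 (ltW C0); rewrite addr_ge0 ?mulr_ge0.
have sB i : i \in s -> moment_le P X N B i by move=> /sK; exact: moment_le_Lnorm.
split.
  apply: le_trans (norm_moment_le mX B0 sN sB) _.
  by rewrite lerDl ltW.
move=> a delta /andP[delta0 delta1] dP /=.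
set th := (r - N%:R) / r; have th0 : 0 < th by rewrite divr_gt0 // subr_gt0.
set D := `|_|.
have key e : 0 < e -> delta <= e -> e <= 1 -> D <= C * e `^ th.
  (* This level balances [e * H ^ N] against the tail term [H ^ (N - r)]. *)
  move=> e0 de e1; pose H := e `^ (- r^-1).
  have H1 : 1 <= H.
    by rewrite /H powRN invf_ge1 ?powR_gt0 // powR_le1 ?(ltW e0) ?invr_ge0 ?(ltW r0).
  have HN : e * H ^+ N = e `^ th.
    rewrite -powR_mulrn ?powR_ge0 // -powRrM -{1}(powRr1 (ltW e0)) -powRD ?(gt_eqF e0) ?implybT //.
    by congr (_ `^ _); rewrite /th mulrBl divff ?gt_eqF // mulNr [_ * N%:R]mulrC.
  have HrN : H `^ (N%:R - r) = e `^ th.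
    by rewrite -powRrM; congr (_ `^ _); rewrite /th mulNr -mulrN opprB mulrC.
  have sT i : i \in s -> \int[P]_w tail_pow N H (X i w) <= H `^ (N%:R - r) * K `^ r.
    by move=> /sK; exact: tail_le_Lnorm.
  have t0 : 0 <= H `^ (N%:R - r) * K `^ r by rewrite mulr_ge0 ?powR_ge0.
  apply: le_trans (moment_split mX H1 B0 t0 (ltW e0) sN sB sT _) _.
    by move=> b c; exact: le_trans (dP H b c) de.
  rewrite -mulrA HN HrN /C [leRHS]mulrDl lerD2l.
  by rewrite -!mulrA ler_wpM2l ?addr_ge0 ?mulr_ge0 // ler_wpM2l // mulrC.
have DC e : 0 <= e -> D <= C * e -> D <= (1 + N%:R * B + C) * e.
  by move=> e0 /le_trans; apply; rewrite ler_wpM2r // lerDr addr_ge0 ?mulr_ge0.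
apply: DC; first exact: powR_ge0.
move: delta0; rewrite le_eqVlt => /predU1P [d0|d0]; last exact: key.
(* For a zero mixing coefficient the cutoff level is infinite: pass to the limit. *)
rewrite -d0 powR0 ?gt_eqF // mulr0 leNgt; apply/negP => D0.
(* Taking [e = t^(1/th)] in [key] gives [D <= C t <= D / 2], a contradiction; the minimum with 1
   keeps [e <= 1]. *)
pose t := Num.min 1 (D / (2 * C)).
have t0 : 0 < t by rewrite lt_min ltr01 divr_gt0 ?mulr_gt0.
have := key (t `^ th^-1); rewrite powR_gt0 // -d0 powR_ge0 -powRrM mulVf ?gt_eqF //.
rewrite powRr1 ?(ltW t0) // => /(_ isT isT).
rewrite powR_le1 ?invr_ge0 ?(ltW th0) ?(ltW t0) ?ge_min ?lexx // => /(_ isT).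
apply/negP; rewrite -ltNge; apply: (@le_lt_trans _ _ (C * (D / (2 * C)))).
  by rewrite ler_wpM2l ?(ltW C0) // ge_min lexx orbT.
rewrite (_ : C * _ = D / 2); last by field; rewrite gt_eqF.
by rewrite ltr_pdivrMr // ltr_pMr // ltr1n.
Qed.

(** * Gaps between the sites of a tuple *)

Section Geometry.
Context {d : nat}.
Implicit Types (x y z : 'rV[int]_d) (s : seq 'rV[int]_d).

Definition site_dist x y : nat := `|mx_norm (x - y)|%N.

Lemma site_distE x y : (site_dist x y)%:Z = mx_norm (x - y).
Proof. by rewrite /site_dist gez0_abs // /mx_norm. Qed.

Lemma site_distxx x : site_dist x x = 0%N.
Proof. by rewrite /site_dist subrr mx_norm0. Qed.

Lemma site_distC x y : site_dist x y = site_dist y x.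
Proof. by rewrite /site_dist -opprB mx_normN. Qed.

Lemma site_dist_triangle x y z : (site_dist x z <= site_dist x y + site_dist y z)%N.
Proof.
rewrite -lez_nat PoszD !site_distE.
by rewrite (_ : x - z = (x - y) + (y - z)) ?ler_mx_norm_add // addrA subrK.
Qed.

Lemma abs_coord_le_dist x y i : (`|(x 0 i - y 0 i)%R| <= site_dist x y)%N.
Proof.
rewrite -lez_nat site_distE mx_normrE abszE.
have := le_bigmax (0 : int) (fun ij : 'I_1 * 'I_d => `|(x - y) ij.1 ij.2|) (0, i).
by rewrite /= !mxE.
Qed.

(* By the pigeonhole principle one of the annuli [{y | j l < |y - x| <= (j + 1) l}],
   [j < n], misses [s]. *)
Lemma exists_gap x s (l : nat) : has (fun y => size s * l < site_dist y x)%N s ->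
  exists a : pred 'rV[int]_d, [/\ a x, ~~ all a s &
    forall i j, i \in x :: s -> j \in x :: s -> a i -> ~~ a j -> (l < site_dist i j)%N].
Proof.
move=> /hasP [y sy yl].
(* The index of the annulus of [z]; the predecessor puts a site at distance exactly [(j + 1) l] into
   annulus [j]. *)
pose f z := ((site_dist z x).-1 %/ l)%N.
(* [y] lies beyond all the annuli, so at most [size s - 1] sites compete for [size s] annuli. *)
have [k kn ks] : exists2 k, (k < size s)%N & k \notin [seq f z | z <- rem y s].
  apply/not_exists2P => /= notk.
  have sub : {subset iota 0 (size s) <= [seq f z | z <- rem y s]}.
    by move=> k; rewrite mem_iota add0n => ks; have [|/negP] := notk k; rewrite ?ks // negbK.
  have := uniq_leq_size (iota_uniq _ _) sub.
  by rewrite size_iota size_map size_rem //; case: (s) sy => //= ? ? _; rewrite ltnn.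
pose a z := (site_dist z x <= k * l)%N.
have gap z : z \in x :: s -> ~~ a z -> (k.+1 * l < site_dist z x)%N.
  rewrite in_cons /a -ltnNge => /predU1P [->|sz]; first by rewrite site_distxx.
  have [-> _|zy] := eqVneq z y; first by apply: leq_ltn_trans yl; rewrite leq_mul2r kn orbT.
  move=> kz; rewrite ltnNge; apply: contra ks => zk; apply/mapP; exists z.
    by move: sz; rewrite (perm_mem (perm_to_rem sy)) in_cons (negPf zy).
  have l0 : (0 < l)%N by case: (l) kz zk => //; rewrite !muln0; lia.
  rewrite /f; apply/esym/eqP; rewrite eqn_leq -ltnS ltn_divLR // leq_divRL //.
  by move: kz zk; case: (site_dist z x) => [|n] /=; rewrite mulSn; lia.
exists a; split.
- by rewrite /a site_distxx.
- apply/allPn; exists y => //; rewrite /a -ltnNge.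
  by apply: leq_ltn_trans yl; rewrite leq_mul2r ltnW ?orbT.
- move=> i j _ js ai /(gap _ js); move: ai; rewrite /a => ai aj.
  have := site_dist_triangle j i x; rewrite (site_distC j i).
  by move: aj; rewrite mulSn; lia.
Qed.

(** The offset [y - x], shifted by [K] in each coordinate, takes values in [0, ..., 2 K] and
    determines [y]. *)
Lemma count_ball x s (K : nat) : uniq s ->
  (count (fun y => site_dist y x <= K)%N s <= (2 * K).+1 ^ d)%N.
Proof.
move=> us; rewrite -size_filter; set t := seq.filter _ s.
have ut : uniq t by rewrite filter_uniq.
pose f y : {ffun 'I_d -> 'I_(2 * K).+1} :=
  [ffun i => inord `|(y 0 i - x 0 i + K%:Z)%R|%N].
have tK y i : y \in t -> (`|(y 0 i - x 0 i)%R| <= K)%N.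
  rewrite mem_filter => /andP[yK _]; exact: leq_trans (abs_coord_le_dist y x i) yK.
have finj : {in t &, injective f}.
  move=> y z ty tz /ffunP fyz; apply/rowP => i.
  have := congr1 val (fyz i); rewrite !ffunE /=.
  have := tK y i ty; have := tK z i tz => hz hy.
  rewrite !inordK; [|lia|lia].
  by lia.
rewrite -(size_map f).
have uf : uniq [seq f y | y <- t] by rewrite map_inj_in_uniq.
rewrite -(card_uniqP uf); apply: leq_trans (max_card _) _.
by rewrite card_ffun !card_ord.
Qed.

End Geometry.

(** * Summation by parts and counting of tuples without a gap *)

Section Abel.
Context {R : realFieldType}.

Lemma exprS_diff_le (m D : nat) :
  m.+1%:R ^+ D - m%:R ^+ D <= D%:R * m.+1%:R ^+ D.-1 :> R.
Proof.
case: D => [|D]; first by rewrite !expr0 subrr mul0r.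
elim: D => [|D IHD]; first by rewrite !expr1 expr0 mulr1 -natr1 addrAC subrr add0r.
rewrite exprS [m%:R ^+ _]exprS -[D.+2.-1]/D.+1.
rewrite (_ : _ - _ = m.+1%:R * (m.+1%:R ^+ D.+1 - m%:R ^+ D.+1) + m%:R ^+ D.+1).
  rewrite -[D.+2%:R]natr1 mulrDl mul1r; apply: lerD.
    by rewrite [X in _ <= _ * X]exprS mulrCA ler_wpM2l.
  by rewrite lerXn2r ?nnegrE ?ler_nat.
by rewrite -[m.+1%:R]natr1; ring.
Qed.

(** Passing from [m] to [m + 1] raises the left side by [((m + 1)^D - m^D) b (m + 1)], a discrete
    derivative, which lowers the power of [l] by one. *)
Lemma abel_sum_le (b : nat -> R) (D m : nat) : (forall l, 0 <= b l) -> (0 < m)%N ->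
  m%:R ^+ D * b m + \sum_(1 <= l < m) l%:R ^+ D * (b l - b l.+1) <=
  (D%:R + 1) * \sum_(1 <= l < m.+1) l%:R ^+ D.-1 * b l.
Proof.
move=> b0; case: m => // m _; elim: m => [|m IHm].
  rewrite !big_nat1 big_geq // addr0 !expr1n !mul1r mulrDl mul1r lerDr.
  by rewrite mulr_ge0.
rewrite big_nat_recr //= [X in _ <= _ * X]big_nat_recr //= [leRHS]mulrDr.
apply: (le_trans _ (lerD IHm (lexx _))).
rewrite (_ : _ + _ = (m.+1%:R ^+ D * b m.+1 +
    \sum_(1 <= l < m.+1) l%:R ^+ D * (b l - b l.+1)) +
    (m.+2%:R ^+ D - m.+1%:R ^+ D) * b m.+2); last by ring.
rewrite lerD2l mulrA ler_wpM2r // (le_trans (exprS_diff_le _ _)) //.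
by rewrite ler_wpM2r ?exprn_ge0 // lerDl.
Qed.

End Abel.

Section TupleCount.
Context {R : realFieldType} {d : nat}.
Implicit Types (x y : 'rV[int]_d) (s : seq 'rV[int]_d).

(** Since the balls are nested, the bracket telescopes to [b l0], where [l0] is the least [l < m]
    such that the ball of radius [n * l] about [x] contains [s], or [m] if there is none. Written
    with indicators, the bound can be summed over tuples. *)
Lemma le_layers (n : nat) (k : R) (b : nat -> R) (C : R) x s :
    0 <= C -> `|k| <= C * b 0%N ->
    (forall l, has (fun y => n * l < site_dist y x)%N s -> `|k| <= C * b l.+1) ->
  forall m, `|k| <= C * (b m + \sum_(0 <= l < m)
    (b l - b l.+1) * (all (fun y => site_dist y x <= n * l)%N s)%:R).
Proof.
move=> C0 k0 kl; elim=> [|m IHm]; first by rewrite big_geq // addr0.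
rewrite big_nat_recr //=.
case: (boolP (all _ s)) => [_|] /=.
  by rewrite mulr1 [X in C * X](_ : _ = b m + \sum_(0 <= l < m)
    (b l - b l.+1) * (all (fun y => site_dist y x <= n * l)%N s)%:R) //; ring.
move=> nall; rewrite mulr0 addr0 big_nat_cond big1 ?addr0 => [|l /andP[/andP[_ lm] _]].
  apply: kl; move: nall; rewrite -has_predC.
  by apply: sub_has => y /=; rewrite -ltnNge.
rewrite (_ : all _ s = false) ?mulr0 //; apply: contraNF nall.
apply: sub_all => y yl; apply: leq_trans yl _.
by rewrite leq_mul2l (ltnW lm) orbT.
Qed.

Lemma tuple_sum_layers (T : seq 'rV[int]_d) (n : nat)
    (k : 'rV[int]_d -> seq 'rV[int]_d -> R) (b : nat -> R) (C : R) :
    uniq T -> 0 <= C -> (forall l, 0 <= b l) -> (forall l, b l.+1 <= b l) ->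
    (forall x s, x \in T -> size s = n -> all (mem T) s -> `|k x s| <= C * b 0%N) ->
    (forall x s l, x \in T -> size s = n -> all (mem T) s ->
       has (fun y => n * l < site_dist y x)%N s -> `|k x s| <= C * b l.+1) ->
  forall m, \sum_(x <- T) tuple_sum T n (fun s => `|k x s|) <=
    C * (size T)%:R * ((size T)%:R ^+ n * b m +
      \sum_(0 <= l < m) (b l - b l.+1) * (2 * (n * l)).+1%:R ^+ (d * n)).
Proof.
move=> uT C0 b0 bS k0 kl m.
apply: (@le_trans _ _ (\sum_(x <- T) C * ((size T)%:R ^+ n * b m +
    \sum_(0 <= l < m) (b l - b l.+1) * (2 * (n * l)).+1%:R ^+ (d * n)))); last first.
  by rewrite big_const_seq count_predT iter_addr_0 -(mulr_natr (C * _)) mulrAC.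
rewrite big_seq [leRHS]big_seq; apply: ler_sum => x xT.
apply: (@le_trans _ _ (tuple_sum T n (fun s => C * (b m + \sum_(0 <= l < m)
    (b l - b l.+1) * (all (fun y => site_dist y x <= n * l)%N s)%:R)))).
  apply: le_tuple_sum => s sn sT; apply: le_layers => //; first exact: k0.
  by move=> l; exact: kl.
rewrite tuple_sumZ tuple_sumD tuple_sum_cst ler_wpM2l // lerD2l.
rewrite tuple_sum_sum; apply: ler_sum => l _.
rewrite tuple_sumZ ler_wpM2l ?subr_ge0 // tuple_sum_all exprM lerXn2r ?nnegrE ?exprn_ge0 //.
by rewrite -natrX ler_nat count_ball.
Qed.

(** Tuples that leave every ball are counted trivially by [(size T) ^ n]; the hypothesis
    [size T <= m.+1 ^ d] makes this comparable to [m ^ (d * n)], the boundary term of the summation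
    by parts. The base [2 n + 1] comes from [2 n l + 1 <= (2 n + 1) l] for [l >= 1]; the ball with
    [l = 0] yields the separate [b 0]. *)
Lemma tuple_sum_gap (T : seq 'rV[int]_d) (n m : nat)
    (k : 'rV[int]_d -> seq 'rV[int]_d -> R) (b : nat -> R) (C : R) :
    uniq T -> 0 <= C -> (forall l, 0 <= b l) -> (forall l, b l.+1 <= b l) ->
    (forall x s, x \in T -> size s = n -> all (mem T) s -> `|k x s| <= C * b 0%N) ->
    (forall x s l, x \in T -> size s = n -> all (mem T) s ->
       has (fun y => n * l < site_dist y x)%N s -> `|k x s| <= C * b l.+1) ->
    (0 < n)%N -> (0 < m)%N -> (size T <= m.+1 ^ d)%N ->
  \sum_(x <- T) tuple_sum T n (fun s => `|k x s|) <=
    C * ((2 * n).+1%:R ^+ (d * n) * ((d * n)%:R + 1)) * (size T)%:R *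
    (b 0%N + \sum_(1 <= l < m.+1) l%:R ^+ (d * n).-1 * b l).
Proof.
move=> uT C0 b0 bS k0 kl n0 m0 Tm.
apply: le_trans (tuple_sum_layers uT C0 b0 bS k0 kl m) _.
set D := (d * n)%N; set A : R := (2 * n).+1%:R ^+ D.
have A1 : 1 <= A by rewrite exprn_ege1 // ler1n.
have A0 : 0 <= A := le_trans ler01 A1.
have big1 : (size T)%:R ^+ n * b m <= A * (m%:R ^+ D * b m).
  rewrite mulrA ler_wpM2r // -exprMn.
  apply: (@le_trans _ _ ((m.+1%:R ^+ d) ^+ n)).
    by rewrite lerXn2r ?nnegrE ?exprn_ge0 // -natrX ler_nat.
  rewrite -exprM lerXn2r ?nnegrE ?mulr_ge0 // -natrM ler_nat.
  by rewrite mulSn; case: (m) m0 (n) n0 => // m' _ [//|n'] _; nia.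
have big2 : \sum_(0 <= l < m) (b l - b l.+1) * (2 * (n * l)).+1%:R ^+ D <=
    A * (b 0%N + \sum_(1 <= l < m) l%:R ^+ D * (b l - b l.+1)).
  rewrite big_ltn // mulrDr lerD //.
    rewrite muln0 muln0 expr1n mulr1 (le_trans (_ : _ <= b 0%N)) ?gerBl //.
    by rewrite ler_peMl.
  rewrite mulr_sumr [X in _ <= X]big_nat_cond [X in X <= _]big_nat_cond.
  apply: ler_sum => l /andP[/andP[l1 _] _].
  rewrite mulrA mulrC ler_wpM2r ?subr_ge0 // -exprMn.
  rewrite lerXn2r ?nnegrE ?mulr_ge0 // -natrM ler_nat.
  by rewrite mulSn; lia.
have := @abel_sum_le R b D m b0 m0.
set S := \sum_(1 <= l < m.+1) _ => abel.
have S0 : 0 <= S by rewrite sumr_ge0 // => l _; rewrite mulr_ge0 ?exprn_ge0.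
rewrite (_ : C * _ * _ * _ = C * (size T)%:R * ((A * (D%:R + 1)) * (b 0%N + S))); last by ring.
rewrite ler_wpM2l ?mulr_ge0 // (le_trans (lerD big1 big2)) // -mulrDr -mulrA ler_wpM2l //.
rewrite addrCA mulrDr lerD // mulrDl mul1r lerDr.
by rewrite mulr_ge0.
Qed.

End TupleCount.

(** * The cumulant of the sum as a sum of joint cumulants *)

Section TupleIntegral.
Context {R : realType} {d : measure_display} {Omega : measurableType d}.
Variable P : probability Omega R.
Context {I : eqType}.

Local Notation intg f := (P.-integrable setT (EFin \o f)).

Lemma Rintegral_sum_seq (s : seq I) (F : I -> Omega -> R) :
  (forall i, i \in s -> intg (F i)) ->
  \int[P]_w (\sum_(i <- s) F i w) = \sum_(i <- s) \int[P]_w F i w.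
Proof.
move=> iF.
have eqF w : \sum_(i <- s) F i w = \sum_(i <- s) (if i \in s then F i w else 0).
  by rewrite big_seq [RHS]big_seq; apply: eq_bigr => i ->.
under eq_Rintegral do rewrite eqF.
rewrite Rintegral_sum => [|i].
  by rewrite big_seq [RHS]big_seq; apply: eq_bigr => i ->.
case: (boolP (i \in s)) => [/iF //|_].
by apply: (@integrable_bounded _ _ _ _ _ 0) => // w; rewrite normr0.
Qed.

Lemma integrable_tuple_sum (T : seq I) k (F : seq I -> Omega -> R) :
  (forall s, size s = k -> all (mem T) s -> intg (F s)) ->
  intg (fun w => tuple_sum T k (fun s => F s w)).
Proof.
elim: k F => [|k IHk] F iF /=; first exact: iF.
apply: integrable_sum_seq => i iT; apply: (IHk (fun s => F (i :: s))) => s sk sT.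
by apply: iF => /=; rewrite ?sk // iT.
Qed.

Lemma Rintegral_tuple_sum (T : seq I) k (F : seq I -> Omega -> R) :
  (forall s, size s = k -> all (mem T) s -> intg (F s)) ->
  \int[P]_w tuple_sum T k (fun s => F s w) = tuple_sum T k (fun s => \int[P]_w F s w).
Proof.
elim: k F => [//|k IHk] F iF /=.
have iFi i : i \in T -> forall s, size s = k -> all (mem T) s -> intg (F (i :: s)).
  by move=> iT s sk sT; apply: iF => /=; rewrite ?sk // iT.
rewrite Rintegral_sum_seq => [|i iT]; last first.
  by apply: (@integrable_tuple_sum _ _ (fun s => F (i :: s))); exact: iFi.
apply: eq_big_seq => i iT.
by apply: (IHk (fun s => F (i :: s))); exact: iFi.
Qed.

End TupleIntegral.

Lemma sum_exprE (R : realFieldType) (I : eqType) (T : seq I) (x : I -> R) k :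
  (\sum_(i <- T) x i) ^+ k = tuple_sum T k (fun s => \prod_(i <- s) x i).
Proof.
elim: k => [|k IHk] /=; first by rewrite big_nil expr0.
rewrite exprS IHk mulr_suml; apply: eq_bigr => i _; rewrite -tuple_sumZ.
by apply: eq_tuple_sum => s _ _; rewrite big_cons.
Qed.

Section FieldCumulant.
Context {R : realType} {disp : measure_display} {Omega : measurableType disp}.
Variable P : probability Omega R.
Variables (d : nat) (X : 'rV[int]_d -> {RV P >-> R}) (T : {fset 'rV[int]_d}).

(** Expanding powers makes the moments of the sum tuple sums of joint moments, so
    [log_poly_tuple_sum] applies to the moments rescaled by [c]; homogeneity then takes [c] out. *)
Lemma cumulant_field_sum (c : R) n :
    (forall s, (size s <= n.+1)%N -> all (mem T) s ->
       P.-integrable setT (EFin \o (fun w => \prod_(i <- s) X i w))) ->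
  cumulant P (fun w => c * field_sum X T w) n.+1 =
  c ^+ n.+1 * \sum_(x <- T) tuple_sum T n (joint_cumulant (moment P X) x).
Proof.
move=> iX; set W := fun w => _.
rewrite /cumulant -/(log_poly n.+1 (mgf_poly P W n.+1)).
pose m s := c ^+ size s * moment P X s.
rewrite (@log_poly_tuple_sum _ _ (T : seq 'rV[int]_d) m) //.
- rewrite mulr_sumr; apply: eq_bigr => x _; rewrite -tuple_sumZ.
  by apply: eq_tuple_sum => s <- _; rewrite joint_cumulant_homog.
- by rewrite /m moment_nil mulr1.
move=> k kn; rewrite coef_poly ltnS kn mulrC divfK ?pnatr_eq0 -?lt0n ?fact_gt0 //.
rewrite unlock.
transitivity (\int[P]_w (c ^+ k * tuple_sum T k (fun s => \prod_(i <- s) X i w))).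
  by congr fine; apply: eq_integral => w _; rewrite /W exprMn -sum_exprE.
have iXk s : size s = k -> all (mem T) s ->
    P.-integrable setT (EFin \o (fun w => \prod_(i <- s) X i w)).
  by move=> sk; apply: iX; rewrite sk.
rewrite RintegralZl //; last exact: integrable_tuple_sum.
rewrite Rintegral_tuple_sum // -tuple_sumZ.
by apply: eq_tuple_sum => s sk _; rewrite /m sk.
Qed.

End FieldCumulant.

Lemma box_radius_gt0 (R : realType) d N : (0 < d)%N -> (0 < N)%N -> (0 < box_radius R d N)%N.
Proof.
move=> d0 N0; rewrite /box_radius truncn_gt0 -[leLHS](congr1 (fun g => g (d%:R^-1)) (powR1 R)).
by rewrite ge0_ler_powR ?nnegrE ?invr_ge0 // ler1n.
Qed.

Lemma box_radius_le (R : realType) d N : (0 < d)%N ->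
  (box_radius R d N)%:R <= N%:R `^ d%:R^-1 :> R.
Proof. by move=> d0; rewrite /box_radius truncn_le // powR_ge0. Qed.

Lemma lt_box_radius (R : realType) d N : (0 < d)%N -> (N < (box_radius R d N).+1 ^ d)%N.
Proof.
move=> d0; rewrite -(ltr_nat R) natrX.
have := truncnS_gt (N%:R `^ d%:R^-1 : R); rewrite -/(box_radius R d N) => h.
have : (N%:R `^ d%:R^-1) ^+ d < (box_radius R d N).+1%:R ^+ d :> R.
  by rewrite ltrXn2r ?nnegrE ?powR_ge0 // -lt0n.
by rewrite -powR_mulrn ?powR_ge0 // -powRrM mulVf ?powRr1 // pnatr_eq0 -lt0n.
Qed.

Lemma ratio_exp_gt0 (R : realType) (r : \bar R) (a : R) :
  0 <= a -> (a%:E < r)%E -> 0 < ratio_exp r a.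
Proof.
case: r => //= r a0; rewrite lte_fin => ar.
by rewrite divr_gt0 ?subr_gt0 // (le_lt_trans a0 ar).
Qed.

(** * The mixing bound for the sum of joint cumulants *)

Section SplitMoments.
Context {R : realType} {d : nat} {disp : measure_display} {Omega : measurableType disp}.
Variables (P : probability Omega R) (X : 'rV[int]_d -> {RV P >-> R}).

(** An integer distance greater than [l] is at least [l.+1], hence the index of the coefficient.
    Repeated sites only lower the cardinality of the first group. *)
Lemma split_dependence_le (T : {fset 'rV[int]_d}) (p l : nat) (s : seq 'rV[int]_d)
    (a : pred 'rV[int]_d) H (b c : R) :
    all (mem T) s -> (size (seq.filter a s) <= p.+1)%N ->
    (forall i j, i \in s -> j \in s -> a i -> ~~ a j -> (l < site_dist i j)%N) ->
    let E := [set w | b <= \prod_(i <- seq.filter a s) truncate H (X i w)] in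
    let F := [set w | c <= \prod_(i <- seq.filter (predC a) s) truncate H (X i w)] in
  `|fine (P (E `&` F)) - fine (P E) * fine (P F)| <= alpha_coef X T p.+1 l.+1.
Proof.
move=> /allP sT sp gap /=.
pose U1 := [fset i in seq.filter a s]%fset.
pose U2 := [fset i in seq.filter (predC a) s]%fset.
have mU1 i : (i \in U1) = (i \in seq.filter a s) by rewrite in_fset.
have mU2 i : (i \in U2) = (i \in seq.filter (predC a) s) by rewrite in_fset.
apply: le_trans (alpha_coef_ge (U1 := U1) (U2 := U2) _ _ _ _ _).
- apply: alpha_mixing_ge; apply: sigma_field_level_prod_truncate => i;
    by rewrite ?mU1 ?mU2.
- by apply/fsubsetP => i; rewrite mU1 mem_filter => /andP[_ /sT].
- by apply/fsubsetP => i; rewrite mU2 mem_filter => /andP[_ /sT].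
- by rewrite card_fseq (leq_trans (size_undup _)).
- move=> i j; rewrite mU1 mU2 !mem_filter => /andP[ai si] /andP[aj sj].
  by rewrite -site_distE lez_nat; exact: gap.
Qed.

End SplitMoments.

Lemma joint_cumulant_sum_le (R : realType) (d p : nat) (r : \bar R) (K : R) :
    (0 < d)%N -> (p.+2%:R%:E < r)%E -> 1 <= K ->
  exists2 C, 0 <= C &
    forall (disp : measure_display) (Omega : measurableType disp)
      (P : probability Omega R) (X : 'rV[int]_d -> {RV P >-> R})
      (T : {fset 'rV[int]_d}),
      T != fset0 -> (forall i, i \in T -> ('N[P]_r[EFin \o X i] <= K%:E)%E) ->
    `|\sum_(x <- T) tuple_sum T p.+1 (joint_cumulant (moment P X) x)| <=
    C * #|` T|%:R * (1 + \sum_(1 <= l < (box_radius R d #|` T|).+1)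
      l%:R ^+ (d * p.+1).-1 * alpha_coef X T p.+1 l `^ ratio_exp r p.+2%:R).
Proof.
move=> d0 pr K1; set th := ratio_exp r _.
have th0 : 0 < th by apply: ratio_exp_gt0.
have [B B0 cov] := moment_cov pr K1.
(* [B + B * B] bounds both the moments, by [B], and the factorized moments, by [B * B]. *)
have BB0 : 0 <= B + B * B by rewrite addr_ge0 ?mulr_ge0.
have [D1 D10 bnd] := @joint_cumulant_bound 'rV[int]_d R (B + B * B) p.+1 BB0.
have [D2 D20 lip] := @joint_cumulant_lipschitz 'rV[int]_d R (B + B * B) p.+1 BB0.
pose C := D1 + D2 * B.
have C0 : 0 <= C by rewrite addr_ge0 ?mulr_ge0.
exists (C * ((2 * p.+1).+1%:R ^+ (d * p.+1) * ((d * p.+1)%:R + 1))).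
  by rewrite mulr_ge0 // mulr_ge0 ?exprn_ge0 ?addr_ge0.
move=> disp Omega P X T T0 XK.
(* The value [b 0 = 1] encodes the plain bound for tuples without a gap; it becomes the leading 1 of
   the claim. *)
pose b l : R := if l is 0%N then 1 else alpha_coef X T p.+1 l `^ th.
have mX i : measurable_fun setT (X i) by exact: measurable_funPT.
have sK s : all (mem T) s -> forall i, i \in s -> ('N[P]_r[EFin \o X i] <= K%:E)%E.
  by move=> /allP sT i /sT; exact: XK.
have mB s : (size s <= p.+2)%N -> all (mem T) s -> `|moment P X s| <= B.
  by move=> sp sT; have [] := cov _ _ P _ X s mX sp (sK s sT).
have sub x s u : x \in T -> size s = p.+1 -> all (mem T) s -> subseq u (x :: s) ->
    (size u <= p.+2)%N /\ all (mem T) u.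
  move=> xT sp sT us; split; first by have := size_subseq us; rewrite /= sp.
  by apply/allP => y /(mem_subseq us); rewrite in_cons => /predU1P[->//|]; exact/allP.
have T1 : (0 < #|` T|)%N by rewrite cardfs_gt0.
apply: le_trans (ler_norm_sum _ _ _) _.
apply: le_trans (ler_sum _ (fun x _ => le_norm_tuple_sum _ _ _)) _.
have main := @tuple_sum_gap R d T p.+1 (box_radius R d #|` T|)
  (joint_cumulant (moment P X)) b C (fset_uniq T) C0.
apply: le_trans (main _ _ _ _ _ _ _) _ => //.
- by case=> [|l] /=; rewrite ?ler01 ?powR_ge0.
- case=> [|l] /=; first by rewrite powR_le1 ?(ltW th0) // alpha_coef_ge0 alpha_coef_le1.
  by rewrite ge0_ler_powR ?nnegrE ?alpha_coef_ge0 ?(ltW th0) // le_alpha_coef.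
- move=> x s xT sp sT; rewrite /= mulr1 /C.
  apply: (@le_trans _ _ D1); last by rewrite lerDl mulr_ge0.
  apply: bnd; first by rewrite sp.
  move=> u /(sub _ _ _ xT sp sT) [up uT]; apply: le_trans (mB u up uT) _.
  by rewrite lerDl mulr_ge0.
- move=> x s l xT sp sT; rewrite -{1}sp => /exists_gap [a [ax nas gap]] /=.
  apply: (@le_trans _ _ (D2 * B * alpha_coef X T p.+1 l.+1 `^ th)); last first.
    by rewrite ler_wpM2r ?powR_ge0 // /C lerDr.
  (* The cumulant of the factorized moments is 0, so subtracting it changes nothing and leaves a
     difference for the Lipschitz bound. *)
  have := joint_cumulant_split s (moment_nil P X) ax; rewrite (negPf nas) => k0.
  rewrite -[joint_cumulant _ _ _]subr0 -[X in _ - X]k0 -mulrA.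
  apply: lip => [|u us]; first by rewrite sp.
  have [up uT] := sub _ _ _ xT sp sT us.
  have subf q : (size (seq.filter q u) <= p.+2)%N /\ all (mem T) (seq.filter q u).
    split; first by rewrite (leq_trans _ up) // size_filter count_size.
    by apply/allP => y; rewrite mem_filter => /andP[_]; exact/allP.
  have BM : `|moment P X (seq.filter a u) * moment P X (seq.filter (predC a) u)| <= B * B.
    have [? ?] := subf a; have [? ?] := subf (predC a).
    by rewrite normrM ler_pM //; apply: mB.
  split.
  + by apply: le_trans (mB u up uT) _; rewrite lerDl mulr_ge0.
  + by apply: le_trans BM _; rewrite lerDr.
  (* If [u] stays inside [a], the factorization is exact. Otherwise at most [p.+1] of its at most
     [p.+2] sites lie in [a], as the mixing order demands. *)
  case: (boolP (all a u)) => [au|nau].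
    have /all_filterP -> := au.
    rewrite (_ : seq.filter (predC a) u = [::]) ?moment_nil ?mulr1 ?subrr ?normr0.
      by rewrite mulr_ge0 ?powR_ge0.
    by apply/eqP; rewrite -(negbK (_ == _)) -has_filter has_predC au.
  have [_ covu] := cov _ _ P _ X u mX up (sK u uT).
  apply: covu => [|H c c' /=]; first by rewrite alpha_coef_ge0 alpha_coef_le1.
  apply: split_dependence_le => //.
    rewrite -ltnS (leq_trans _ up) // -(count_predC a u) size_filter.
    by rewrite -addn1 leq_add2l -has_count has_predC.
  by move=> i j iu ju; exact: gap (mem_subseq us iu) (mem_subseq us ju).
- exact: box_radius_gt0.
- exact: ltnW (lt_box_radius _ _ d0).
- rewrite le_eqVlt; apply/orP; left; apply/eqP; congr (_ * (_ + _)).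
  by apply: eq_big_nat => l /andP[l1 _]; case: l l1.
Qed.

(** * Sums of powers *)

Section PowerSums.
Context {R : realType}.
Implicit Types (c : R) (l m : nat).

(** After exponentiation this is [1 + x <= exp x] at [x = - 1 / (l + 1)]. *)
Lemma ln_succ_ge l : (0 < l)%N -> l.+1%:R^-1 <= ln l.+1%:R - ln l%:R :> R.
Proof.
move=> l0; have l0' : 0 < l%:R :> R by rewrite ltr0n.
have S0 : 0 < l.+1%:R :> R by rewrite ltr0n.
rewrite -ler_expR expRB !lnK ?posrE //.
rewrite -[leLHS]invrK -expRN -[leRHS]invrK lef_pV2 ?posrE ?invr_gt0 ?expR_gt0 ?divr_gt0 //.
apply: le_trans (expR_ge1Dx _); rewrite invf_div.
by rewrite -[l.+1%:R]natr1 ler_pdivrMr ?natr1 // mulrBl mul1r mulVf ?gt_eqF // -natr1; lra.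
Qed.

(** A discrete substitute for comparison with an integral; it drives the inductions for both power
    sums below. *)
Lemma powR_pred_le c l : 0 < c -> (0 < l)%N ->
  l%:R `^ c * (1 + c / l.+1%:R) <= l.+1%:R `^ c :> R.
Proof.
move=> c0 l0; have l0' : 0 < l%:R :> R by rewrite ltr0n.
have S0 : 0 < l.+1%:R :> R by rewrite ltr0n.
rewrite /powR !gt_eqF // (_ : c * ln l.+1%:R = c * ln l%:R + c * (ln l.+1%:R - ln l%:R)).
  rewrite expRD ler_wpM2l ?expR_ge0 // (le_trans (expR_ge1Dx _)) // ler_expR.
  by rewrite ler_wpM2l ?(ltW c0) // ln_succ_ge.
by ring.
Qed.

(** The constant [1 / c] suggested by the integral fails at [m = 1] when [c > 1]. With [(1 + c) / c]
    the inductive step reduces to [c / m.+2 <= c], whatever the sign of [c - 1]. *)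
Lemma sum_powR_le c m : 0 < c -> (0 < m)%N ->
  \sum_(1 <= l < m.+1) l%:R `^ (c - 1) <= (1 + c) / c * m%:R `^ c :> R.
Proof.
move=> c0; case: m => // m _; elim: m => [|m IHm].
  by rewrite big_nat1 !powR1 mulr1 ler_pdivlMr // mul1r lerDr.
rewrite big_nat_recr //= (le_trans (lerD IHm (lexx _))) //.
have S0 : 0 < m.+2%:R :> R by rewrite ltr0n.
have pE : m.+2%:R `^ (c - 1) = m.+2%:R `^ c / m.+2%:R :> R.
  by rewrite powRD ?(gt_eqF S0) ?implybT // powR_inv1 // ltW.
have := @powR_pred_le c m.+1 c0 isT; rewrite pE.
set A := m.+1%:R `^ c; set B := m.+2%:R `^ c => AB.
have B0 : 0 < B by rewrite powR_gt0.
have y0 : 0 < c / m.+2%:R by rewrite divr_gt0.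
have yc : c / m.+2%:R <= c by rewrite ler_pdivrMr // ler_peMr ?(ltW c0) // ler1n.
have AB' : A <= B / (1 + c / m.+2%:R) by rewrite ler_pdivlMr // addr_gt0.
apply: (@le_trans _ _ ((1 + c) / c * (B / (1 + c / m.+2%:R)) + B / m.+2%:R)).
  by rewrite lerD2r ler_wpM2l // divr_ge0 ?addr_ge0 ?(ltW c0).
set y := c / m.+2%:R in y0 yc AB' *.
rewrite (_ : B / m.+2%:R = (1 + c) / c * (B * (y / (1 + c)))); last first.
  by rewrite /y; field; rewrite !gt_eqF // addr_gt0.
rewrite -mulrDr -mulrDr ler_wpM2l ?divr_ge0 ?addr_ge0 ?(ltW c0) //.
rewrite ler_piMr ?(ltW B0) // -lerBrDr.
rewrite -[leLHS]mul1r ler_pdivrMr ?addr_gt0 // mulrBl mul1r mulrDr mulr1.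
have c10 : 0 < 1 + c by rewrite addr_gt0.
suff : y / (1 + c) * (1 + y) <= y by lra.
by rewrite mulrAC ler_pdivrMr // ler_wpM2l ?(ltW y0) // lerD2l.
Qed.

Lemma sum_powRN_le c m : 0 < c ->
  \sum_(1 <= l < m.+1) l%:R `^ (- 1 - c) <= 1 + c^-1 :> R.
Proof.
move=> c0; case: m => [|m]; first by rewrite big_geq // addr_ge0 ?invr_ge0 ?(ltW c0).
(* The induction needs the stronger bound that retains the tail [m^(-c) / c] of the integral. *)
apply: (@le_trans _ _ (1 + (1 - m.+1%:R `^ (- c)) / c)); last first.
  rewrite lerD2l mulrBl mul1r gerBl divr_ge0 ?powR_ge0 //; exact: ltW.
elim: m => [|m IHm]; first by rewrite big_nat1 !powR1 subrr mul0r addr0.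
rewrite big_nat_recr //= (le_trans (lerD IHm (lexx _))) //.
have S0 : 0 < m.+2%:R :> R by rewrite ltr0n.
have pE : m.+2%:R `^ (- 1 - c) = m.+2%:R `^ (- c) / m.+2%:R :> R.
  by rewrite addrC powRD ?(gt_eqF S0) ?implybT // powR_inv1 // ltW.
rewrite -addrA lerD2l pE.
have := @powR_pred_le c m.+1 c0 isT; rewrite !powRN.
set A := m.+1%:R `^ c; set B := m.+2%:R `^ c => AB.
have A0 : 0 < A by rewrite powR_gt0.
have B0 : 0 < B by rewrite powR_gt0.
have AB' : B^-1 * (1 + c / m.+2%:R) <= A^-1.
  by rewrite mulrC ler_pdivrMr // [leRHS]mulrC ler_pdivlMr // mulrC.
rewrite ler_pdivlMr // mulrDl divfK ?gt_eqF // -mulrA [_ * c]mulrC.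
move: AB'; rewrite mulrDr mulr1; move: (B^-1 * _) => z.
move: A^-1 B^-1 => A' B' ?; lra.
Qed.

Lemma sum_inv_le m : (0 < m)%N ->
  \sum_(1 <= l < m.+1) l%:R^-1 <= 1 + ln m%:R :> R.
Proof.
case: m => // m _; elim: m => [|m IHm]; first by rewrite big_nat1 ln1 addr0 invr1.
rewrite big_nat_recr //= (le_trans (lerD IHm (lexx _))) //.
by rewrite -addrA lerD2l -lerBrDl; exact: ln_succ_ge.
Qed.

End PowerSums.

(** * Conclusion *)

Lemma limn_einf_gt0 (R : realType) (u : nat -> R) :
  (0 < limn_einf (EFin \o u))%E ->
  exists2 c, 0 < c & exists n0, forall n, (n0 <= n)%N -> c <= u n.
Proof.
rewrite limn_einf_lim (cvg_lim _ (cvg_einfs_sup (u := EFin \o u))) // => /ereal_sup_gt [_ [n0 _ <-]].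
rewrite /einfs /= => u0.
have lb n : (n0 <= n)%N -> (ereal_inf (sdrop (EFin \o u) n0) <= (u n)%:E)%E.
  by move=> n0n; apply: ereal_inf_lbound; exists n.
case: (ereal_inf _) u0 lb => [c c0 lb|_ lb|//].
exists c; first by rewrite -lte_fin.
  by exists n0 => n /lb; rewrite lee_fin.
by have := lb n0 (leqnn _); rewrite leye_eq.
Qed.

Lemma integrable_prod_Lnorm (R : realType) (N : nat) (r : \bar R) (K : R)
    (d : measure_display) (Omega : measurableType d) (P : probability Omega R)
    (I : eqType) (X : I -> Omega -> R) (s : seq I) :
    (N%:R%:E < r)%E -> 0 <= K -> (forall i, measurable_fun setT (X i)) ->
    (size s <= N)%N -> (forall i, i \in s -> ('N[P]_r[EFin \o X i] <= K%:E)%E) ->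
  P.-integrable setT (EFin \o (fun w => \prod_(i <- s) X i w)).
Proof.
case: r => [r|_|//]; last first.
  move=> K0 mX sN sK; apply: (@integrable_prodX _ _ _ P _ X mX N (K ^+ N)) => // i /sK.
  exact: moment_le_Linfty.
rewrite lte_fin => Nr K0 mX sN sK.
apply: (@integrable_prodX _ _ _ P _ X mX N (1 + K `^ r)) => // i /sK.
exact: moment_le_Lnorm.
Qed.

Section LimitTheorem.
Variables (R : realType) (d : nat) (T : nat -> {fset 'rV[int]_d}).
Variables (disp : nat -> measure_display) (Omega : forall n, measurableType (disp n)).
Variables (P : forall n, probability (Omega n) R).
Variables (X : forall n, 'rV[int]_d -> {RV (P n) >-> R}) (p : nat) (r : \bar R).
Hypothesis d_gt0 : (0 < d)%N.
Hypothesis T_neq0 : forall n, T n != fset0.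
Hypothesis r_gt : ((p.+2%:R)%:E < r)%E.
Hypothesis var_liminf :
  (0 < limn_einf (fun n => (field_var (X n) (T n) / #|` T n|%:R)%:E))%E.
Hypothesis X_norm :
  (ereal_sup [set x | exists n i, i \in T n /\ x = 'N[P n]_r[EFin \o X n i]] < +oo)%E.

Local Notation N n := #|` T n|.
Local Notation kappa n := (cumulant (P n) (normalized_sum (X n) (T n)) p.+2).
Local Notation S n := (1 + \sum_(1 <= l < (box_radius R d (N n)).+1)
  l%:R ^+ (d * p.+1).-1 * alpha_coef (X n) (T n) p.+1 l `^ ratio_exp r p.+2%:R).

Lemma norm_bounded : exists2 K, 1 <= K &
  forall n i, i \in T n -> ('N[P n]_r[EFin \o X n i] <= K%:E)%E.
Proof.
move: X_norm; set s := ereal_sup _ => sy.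
have ub n i : i \in T n -> ('N[P n]_r[EFin \o X n i] <= s)%E.
  by move=> iT; apply: ereal_sup_ubound; exists n, i.
case: s sy ub => [K _ ub|//|_ ub].
  (* [K] may serve as a truncation level, and these must be at least 1. *)
  exists (Num.max 1 K); first by rewrite le_max lexx.
  by move=> n i /ub /le_trans; apply; rewrite lee_fin le_max lexx orbT.
by exists 1 => // n i /ub /le_trans; apply; exact: leNye.
Qed.

Lemma N_gt0 n : (0 < N n)%N. Proof. by rewrite cardfs_gt0. Qed.

Lemma S_ge1 n : 1 <= S n.
Proof.
by rewrite lerDl sumr_ge0 // => l _; rewrite mulr_ge0 ?exprn_ge0 ?powR_ge0.
Qed.

Lemma cumulant_eventually_le : exists2 C, 0 <= C & exists n0, forall n, (n0 <= n)%N ->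
  `|kappa n| <= C * ((N n)%:R `^ (- (p%:R / 2)) * S n).
Proof.
have [c c0 [n0 cvar]] := limn_einf_gt0 var_liminf.
have [K K1 XK] := norm_bounded.
have [C C0 bnd] := joint_cumulant_sum_le d_gt0 r_gt K1.
exists (C * c `^ (- (p.+2%:R / 2))); first by rewrite mulr_ge0 ?powR_ge0.
exists n0 => n n0n.
have Nn0 : 0 < (N n)%:R :> R by rewrite ltr0n N_gt0.
have := bnd _ _ (P n) (X n) (T n) (T_neq0 n) (XK n).
move=> leS.
have mX i : measurable_fun setT (X n i) by exact: measurable_funPT.
have -> : kappa n = (field_sd (X n) (T n))^-1 ^+ p.+2 *
    \sum_(x <- T n) tuple_sum (T n) p.+1 (joint_cumulant (moment (P n) (X n)) x).
  apply: cumulant_field_sum => s sp sT.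
  apply: (integrable_prod_Lnorm r_gt (le_trans ler01 K1)) => //.
  by move=> i si; apply: XK; move/allP: sT; exact.
rewrite normrM.
have cN0 : 0 < c * (N n)%:R by rewrite mulr_gt0.
have var_ge : c * (N n)%:R <= field_var (X n) (T n).
  by rewrite -ler_pdivlMr // cvar.
have sd_ge : (field_sd (X n) (T n))^-1 ^+ p.+2 <= (c * (N n)%:R) `^ (- (p.+2%:R / 2)).
  have v0 : 0 < field_var (X n) (T n) := lt_le_trans cN0 var_ge.
  rewrite /field_sd exprVn -powR12_sqrt ?(ltW v0) // -powR_mulrn ?powR_ge0 //.
  rewrite -powRrM powRN [2^-1 * _]mulrC lef_pV2 ?posrE ?powR_gt0 //.
  by rewrite ge0_ler_powR ?nnegrE ?divr_ge0 ?(ltW v0) ?(ltW cN0).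
rewrite ger0_norm ?exprn_ge0 ?invr_ge0 ?sqrtr_ge0 //.
apply: le_trans (ler_pM _ _ sd_ge leS) _; rewrite ?exprn_ge0 ?invr_ge0 ?sqrtr_ge0 //.
rewrite powRM ?(ltW c0) ?(ltW Nn0) //.
(* The factor [N n] comes from the free first site of each tuple: [- (p + 2) / 2 + 1 = - p / 2]. *)
have -> : (N n)%:R `^ (- (p%:R / 2)) = (N n)%:R `^ (- (p.+2%:R / 2)) * (N n)%:R :> R.
  rewrite -[X in _ = _ * X]powRr1 ?(ltW Nn0) // -powRD ?(gt_eqF Nn0) ?implybT //.
  by congr (_ `^ _); rewrite -(addn2 p) natrD; lra.
by rewrite le_eqVlt; apply/orP; left; apply/eqP; ring.
Qed.

Lemma cumulant_le : exists C : R, forall n, 0 < field_sd (X n) (T n) ->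
  `|kappa n| <= C * ((N n)%:R `^ (- (p%:R / 2)) * S n).
Proof.
have [C C0 [n0 Cn]] := cumulant_eventually_le.
pose w n : R := (N n)%:R `^ (- (p%:R / 2)).
have w0 n : 0 < w n by rewrite powR_gt0 // ltr0n N_gt0.
(* The limit inferior says nothing about the finitely many indices below [n0]; their cumulants are
   absorbed into the constant, which works because [S n >= 1]. *)
pose C' := \sum_(k < n0) `|kappa k| / w k.
have C'0 : 0 <= C' by rewrite sumr_ge0 // => k _; rewrite divr_ge0 // ltW.
exists (C + C') => n _; rewrite -/(w n).
have wS0 : 0 <= w n * S n by rewrite mulr_ge0 ?(ltW (w0 n)) // (le_trans ler01) // S_ge1.
have [n0n|nn0] := leqP n0 n.
  by apply: le_trans (Cn n n0n) _; rewrite ler_wpM2r // lerDl.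
apply: (@le_trans _ _ (C' * w n)).
  rewrite -ler_pdivrMr // /C' (bigD1 (Ordinal nn0)) //= lerDl sumr_ge0 // => k _.
  by rewrite divr_ge0 // ltW.
by rewrite ler_pM ?(ltW (w0 n)) ?lerDr // ler_peMr ?(ltW (w0 n)) ?S_ge1.
Qed.

Lemma cumulant_bigO (h : nat -> R) (M : R) (n1 : nat) :
    (forall n, (n1 <= n)%N ->
       (N n)%:R `^ (- (p%:R / 2)) * S n <= M * `|h n|) ->
  ((fun n => kappa n) : nat -> R^o) =O_\oo (h : nat -> R^o).
Proof.
move=> hM; have [C C0 [n0 Cn]] := cumulant_eventually_le.
apply/eqO_exP; exists (C * `|M| + 1); first by rewrite ltr_wpDl // mulr_ge0.
near=> n; have n0n : (n0 <= n)%N by near: n; exact: nbhs_infty_ge.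
have n1n : (n1 <= n)%N by near: n; exact: nbhs_infty_ge.
apply: le_trans (Cn n n0n) _.
apply: (@le_trans _ _ (C * (`|M| * `|h n|))).
  by rewrite ler_wpM2l // (le_trans (hM n n1n)) // ler_wpM2r // ler_norm.
by rewrite mulrA ler_wpM2r // lerDl.
Unshelve. all: by end_near. Qed.

End LimitTheorem.

Lemma sum_mixing_le (R : realType) (D m : nat) (q K : R) (a : nat -> R) : (0 < D)%N ->
    (forall l, (1 <= l <= m)%N -> a l <= K * l%:R `^ (- q)) ->
  \sum_(1 <= l < m.+1) l%:R ^+ D.-1 * a l <=
  `|K| * \sum_(1 <= l < m.+1) l%:R `^ (D%:R - 1 - q).
Proof.
move=> D0 aK; rewrite mulr_sumr big_nat_cond [leRHS]big_nat_cond.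
apply: ler_sum => l /andP[/andP[l1 lm] _].
have l0 : l%:R != 0 :> R by rewrite pnatr_eq0 -lt0n.
rewrite powRD ?l0 ?implybT // -(natrB R D0) subn1 powR_mulrn // mulrCA.
rewrite ler_wpM2l ?exprn_ge0 // (le_trans (aK _ _)) ?l1 //.
by rewrite ler_wpM2r ?powR_ge0 // ler_norm.
Qed.

Theorem proposition2p9 (R : realType) (d : nat) (d_gt0 : (0 < d)%N)
  (T : nat -> {fset 'rV[int]_d})
  (T_neq0 : forall n, T n != fset0)
  (T_incr : forall n, (T n `<=` T n.+1)%fset)
  (T_infty : (fun n => #|` T n|) @ \oo --> \oo)
  (disp : nat -> measure_display)
  (Omega : forall n, measurableType (disp n))
  (P : forall n, probability (Omega n) R)
  (X : forall n, 'rV[int]_d -> {RV (P n) >-> R})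
  (X_sq : forall n i, i \in T n ->
     (P n).-integrable setT (fun w => ((X n i w) ^+ 2)%:E))
  (X_mean0 : forall n i, i \in T n -> ('E_(P n)[X n i] = 0)%E)
  (p : nat) (p_gt0 : (0 < p)%N)
  (r : \bar R) (r_gt : ((p.+2%:R)%:E < r)%E)
  (var_liminf : (0 < limn_einf
     (fun n => (field_var (X n) (T n) / #|` T n|%:R)%:E))%E)
  (X_norm : (ereal_sup [set x | exists n i, i \in T n /\
     x = 'N[P n]_r[EFin \o X n i]] < +oo)%E) :
  let N n := #|` T n| in
  let kappa n := cumulant (P n) (normalized_sum (X n) (T n)) p.+2 in
  let a n l := alpha_coef (X n) (T n) p.+1 l `^ ratio_exp r p.+2%:R in
  (exists C : R, forall n, 0 < field_sd (X n) (T n) ->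
     `|kappa n| <= C * ((N n)%:R `^ (- (p%:R / 2)) *
       (1 + \sum_(1 <= l < (box_radius R d (N n)).+1)
              l%:R ^+ (d * p.+1).-1 * a n l)))
  /\
  (forall q : R, 0 < q ->
     (exists K : R, forall n l, (1 <= l <= box_radius R d (N n))%N ->
        a n l <= K * l%:R `^ (- q)) ->
     [/\ (d * p.+1)%:R < q ->
           (kappa : nat -> R^o) =O_\oo
             ((fun n => (N n)%:R `^ (- (p%:R / 2))) : nat -> R^o),
         q = (d * p.+1)%:R ->
           (kappa : nat -> R^o) =O_\oo
             ((fun n => (N n)%:R `^ (- (p%:R / 2)) * ln (N n)%:R)
              : nat -> R^o)
       & q < (d * p.+1)%:R ->
           (kappa : nat -> R^o) =O_\oo
             ((fun n => (N n)%:R `^ (p%:R / 2 + 1 - q / d%:R))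
              : nat -> R^o)]).
Proof.
move=> N kappa a; split.
  by have := cumulant_le d_gt0 T_neq0 r_gt var_liminf X_norm.
move=> q q0 [K aK].
have bigO := cumulant_bigO d_gt0 T_neq0 r_gt var_liminf X_norm.
set D := (d * p.+1)%N in bigO *.
have D0 : (0 < D)%N by rewrite muln_gt0 d_gt0.
have N1 n : (0 < N n)%N by rewrite cardfs_gt0.
have N1R n : 1 <= (N n)%:R :> R by rewrite ler1n.
have N0R n : 0 < (N n)%:R :> R by rewrite ltr0n.
pose m n := box_radius R d (N n).
have m1 n : (0 < m n)%N by exact: box_radius_gt0.
have m_le n : (m n)%:R <= (N n)%:R `^ d%:R^-1 :> R by exact: box_radius_le.
have sum_le n := sum_mixing_le D0 (aK n).
have K0 : 0 <= `|K| by [].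
split => [Dq|qD|qD].
- have c0 : 0 < q - D%:R by rewrite subr_gt0.
  apply: (bigO _ (1 + `|K| * (1 + (q - D%:R)^-1)) 0%N) => n _.
  rewrite (ger0_norm (powR_ge0 _ _)) mulrC ler_wpM2r ?powR_ge0 // lerD2l.
  apply: le_trans (sum_le n) _; rewrite ler_wpM2l //.
  rewrite (_ : D%:R - 1 - q = - 1 - (q - D%:R)); last by ring.
  exact: sum_powRN_le.
(* In the critical case the constant term 1 must be absorbed by the logarithm, so [ln (N n) >= 1] is
   secured first; it holds eventually because [N n] tends to infinity. *)
- have [n1 n1P] : exists n1, forall n, (n1 <= n)%N -> 1 <= ln (N n)%:R :> R.
    have [n1 _ n1P] := T_infty _ (nbhs_infty_ge (Num.truncn (expR 1 : R)).+1).
    exists n1 => n /n1P /= le_N; rewrite -[leLHS]expRK ler_ln ?posrE ?expR_gt0 //.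
    by rewrite (le_trans (ltW (truncnS_gt _))) // ler_nat.
  apply: (bigO _ (1 + `|K| * 2) n1) => n n1n.
  have ln1 := n1P n n1n.
  rewrite [X in _ <= _ * X]ger0_norm ?mulr_ge0 ?powR_ge0 ?(le_trans ler01 ln1) // mulrCA.
  rewrite ler_wpM2l ?powR_ge0 // mulrDl mul1r lerD //.
  apply: le_trans (sum_le n) _; rewrite -mulrA ler_wpM2l //.
  rewrite (eq_big_nat _ _ (F2 := fun l => l%:R^-1)) => [|l _]; last first.
    by rewrite qD addrAC subrr add0r powR_inv1.
  apply: le_trans (sum_inv_le (m1 n)) _.
  rewrite mulr_natl mulr2n lerD // ler_ln ?posrE ?ltr0n ?m1 //.
  apply: le_trans (m_le n) _; rewrite -[leRHS]powRr1 ?(ltW (N0R n)) // ler_powR //.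
  by rewrite invf_le1 ?ltr0n // ler1n.
- have c0 : 0 < D%:R - q by rewrite subr_gt0.
  set c := D%:R - q in c0.
  apply: (bigO _ (1 + `|K| * ((1 + c) / c)) 0%N) => n _.
  rewrite (ger0_norm (powR_ge0 _ _)).
  (* The radius is at most [(N n)^(1/d)], so the sum is of order [(N n)^(c/d)]; since
     [D / d = p + 1], the exponents add up to [p / 2 + 1 - q / d]. *)
  have -> : (N n)%:R `^ (p%:R / 2 + 1 - q / d%:R) =
      (N n)%:R `^ (- (p%:R / 2)) * (N n)%:R `^ (d%:R^-1 * c) :> R.
    rewrite -powRD ?(gt_eqF (N0R n)) ?implybT //; congr (_ `^ _).
    by rewrite /c /D natrM -[p.+1%:R]natr1; field; rewrite pnatr_eq0 -lt0n.
  rewrite mulrCA ler_wpM2l ?powR_ge0 // mulrDl mul1r lerD //.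
    by rewrite -[leLHS](powRr0 (N n)%:R) ler_powR // mulr_ge0 ?invr_ge0 // ltW.
  apply: le_trans (sum_le n) _; rewrite -mulrA ler_wpM2l //.
  rewrite (_ : D%:R - 1 - q = c - 1); last by rewrite /c; ring.
  apply: le_trans (sum_powR_le c0 (m1 n)) _.
  have cc0 : 0 <= (1 + c) / c by rewrite divr_ge0 ?(ltW c0) // (le_trans ler01) // lerDl ltW.
  rewrite ler_wpM2l // powRrM.
  by rewrite ge0_ler_powR ?nnegrE ?powR_ge0 ?(ltW c0).
Qed.
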